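(* There exists a universal constant $C>0$ such that for every $n\ge1$, every $\rho\in[0,1]$, every $\kappa\ge 0$ and every $g:\{-1,1\}^n\to\{0,1\}$ with $\mathrm{MaxInf}(g)\le\kappa$, $$\mathrm{Stab}_\rho(g)\le \Lambda_\rho(\mathbb{E}[g])+\frac{C}{1-\sqrt{\rho}}\,\kappa^{\frac{1-\rho}{27}},$$ where for $\rho=1$ the right-hand side is interpreted as $+\infty$.
   Context: $\{-1,1\}^n$ carries the uniform probability measure $\mu^n$, and $\mathbb{E}[g]=\int g\,d\mu^n$. Influences: $\mathrm{Inf}_i(g)=\int |g(x)-g(x^{\sim i})|\,d\mu^n(x)$, where $x^{\sim i}$ is $x$ with the $i$-th coordinate flipped, and $\mathrm{MaxInf}(g)=\max_{i\in[n]}\mathrm{Inf}_i(g)$. Noise stability: for $x\in\{-1,1\}^n$ and $\rho\in[0,1]$ let $\mathcal{N}_{\rho,x}$ be the random point of $\{-1,1\}^n$ with independent coordinates and $\mathbb{E}[\mathcal{N}_{\rho,x}]=\rho x$; let $T_\rho[g](x)=\mathbb{E}[g(\mathcal{N}_{\rho,x})]$ and $\mathrm{Stab}_\rho(g)=\int g\,T_\rho[g]\,d\mu^n$. Gaussian noise stability: for $a\in(0,1)$, $$\Lambda_\rho(a)=\mathbb{P}\left(G_1\le\Phi^{-1}(a)\text{ and }G_2\le\Phi^{-1}(a)\right),$$ where $(G_1,G_2)$ is a centered jointly Gaussian pair with unit variances and $\mathbb{E}[G_1G_2]=\rho$, and $\Phi(x)=\mathbb{P}(G_1\le x)$ is the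 standard Gaussian CDF. Also $\Lambda_\rho(0)=0$ and $\Lambda_\rho(1)=1$. *)

(* Defs.v *)
(* MathComp + MathComp-Analysis *)
From HB Require Import structures.
From mathcomp Require Import all_boot all_order all_algebra.
From mathcomp Require Import all_classical all_reals all_analysis.

Set Implicit Arguments.
Unset Strict Implicit.
Unset Printing Implicit Defensive.

Import Order.TTheory GRing.Theory Num.Theory.
Import numFieldNormedType.Exports.

Local Open Scope classical_set_scope.
Local Open Scope ring_scope.

(* A point of {-1,1}^n is stored through its sign bits: the i-th coordinate of
   x is the real number [spin x i] = (-1)^(x i). *)
Notation cube n := {ffun 'I_n -> bool}.

Definition spin (R : realType) (n : nat) (x : cube n) (i : 'I_n) : R :=
  (-1) ^+ x i.

Definition flip (n : nat) (i : 'I_n) (x : cube n) : cube n :=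
  [ffun j => if j == i then ~~ x j else x j].

Definition expect (R : realType) (n : nat) (g : cube n -> R) : R :=
  (\sum_x g x) / (2 ^+ n).

Definition Inf (R : realType) (n : nat) (i : 'I_n) (g : cube n -> R) : R :=
  expect (fun x => `|g x - g (flip i x)|).

(* Influences are nonnegative, so for n >= 1 the base value 0 is harmless. *)
Definition MaxInf (R : realType) (n : nat) (g : cube n -> R) : R :=
  \big[Num.max/0]_(i < n) Inf i g.

(* The probability that the noisy copy of x equals y.  The only law on {-1,1}
   with mean rho * x_i gives mass (1 + rho * x_i * y_i) / 2 to y_i, and the
   coordinates are independent. *)
Definition noise (R : realType) (n : nat) (rho : R) (x y : cube n) : R :=
  \prod_(i < n) ((1 + rho * spin R x i * spin R y i) / 2).

Definition Tnoise (R : realType) (n : nat) (rho : R) (g : cube n -> R)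
    (x : cube n) : R :=
  \sum_y noise rho x y * g y.

Definition Stab (R : realType) (n : nat) (rho : R) (g : cube n -> R) : R :=
  expect (fun x => g x * Tnoise rho g x).

Definition Phi (R : realType) (x : R) : R :=
  fine (normal_prob 0 1 `]-oo, x]).

(* The point x with Phi x = a, which exists and is unique when 0 < a < 1;
   a default value otherwise. *)
Definition Phi_inv (R : realType) (a : R) : R := xget 0 [set x | Phi x = a].

(* For Z = (Z_1, Z_2) with independent standard Gaussian coordinates, the
   linear image (G_1, G_2) = (Z_1, rho Z_1 + sqrt(1 - rho^2) Z_2) is the
   centered jointly Gaussian pair with unit variances and E[G_1 G_2] = rho. *)
Definition gauss_pair (R : realType) (rho : R) (z : R * R) : R * R :=
  (z.1, rho * z.1 + Num.sqrt (1 - rho ^+ 2) * z.2).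

Definition Lambda (R : realType) (rho a : R) : \bar R :=
  if a == 0 then 0%E
  else if a == 1 then 1%E
  else (normal_prob (0 : R) 1 \x normal_prob (0 : R) 1)%E
         [set z | (gauss_pair rho z).1 <= Phi_inv a /\
                  (gauss_pair rho z).2 <= Phi_inv a].

Lemma noise_prodE (R : realType) (n : nat) (rho : R) (x : cube n)
    (F : 'I_n -> bool -> R) :
  \sum_y noise rho x y * \prod_(i < n) F i (y i) =
  \prod_(i < n) ((1 + rho * spin R x i) / 2 * F i false +
                 (1 - rho * spin R x i) / 2 * F i true).
Proof.
under eq_bigr do rewrite -big_split /=.
rewrite -(bigA_distr_bigA (fun i b =>
  (1 + rho * spin R x i * (-1) ^+ (b : bool)) / 2 * F i b)) /=.
apply: eq_bigr => i _; rewrite big_bool /= expr0 expr1 mulr1 mulrN1.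
by rewrite addrC.
Qed.

Lemma noise_ge0 (R : realType) (n : nat) (rho : R) (x y : cube n) :
  0 <= rho <= 1 -> 0 <= noise rho x y.
Proof.
move=> /andP[r0 r1]; apply: prodr_ge0 => i _; apply: divr_ge0 => //.
rewrite -mulrA /spin -signr_addb; case: (_ (+) _).
  by rewrite expr1 mulrN1 subr_ge0.
by rewrite expr0 mulr1 addr_ge0.
Qed.

Lemma noise_sum1 (R : realType) (n : nat) (rho : R) (x : cube n) :
  \sum_y noise rho x y = 1.
Proof.
have := noise_prodE rho x (fun _ _ => 1).
under eq_bigr do rewrite big1 // mulr1.
move=> ->; rewrite big1 // => i _.
by rewrite !mulr1 -mulrDl addrACA subrr addr0 divff.
Qed.

Lemma noise_mean (R : realType) (n : nat) (rho : R) (x : cube n) (i : 'I_n) :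
  \sum_y noise rho x y * spin R y i = rho * spin R x i.
Proof.
have := noise_prodE rho x (fun j b => if j == i then (-1) ^+ b else 1).
have E (y : cube n) :
    \prod_(j < n) (if j == i then (-1) ^+ y j else 1 : R) = spin R y i.
  by rewrite -big_mkcond big_pred1_eq.
under eq_bigr do rewrite E.
move=> ->; rewrite (bigD1 i) //= eqxx big1 => [|j /negPf ->].
  rewrite mulr1 expr0 expr1 mulr1 mulrN1 -mulrBl opprB addrC.
  rewrite addrA subrK -mulr2n -[_ *+ 2]mulr_natr mulfK //.
by rewrite !mulr1 -mulrDl addrACA subrr addr0 divff.
Qed.

(* Main.v *)
Require Import Defs.
From HB Require Import structures.
From mathcomp Require Import all_boot all_order all_algebra.
From mathcomp Require Import all_classical all_reals all_analysis.
From mathcomp Require Import measurable_realfun ring lra.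
Import Order.TTheory GRing.Theory Num.Theory.
Import numFieldNormedType.Exports.
Local Open Scope ring_scope.

(* Let r = sqrt rho. Since T_r is symmetric, Stab_rho(h) = E[(T_r h)^2]. For s in
   [0, r] put psi(s) = E[V(k(s), Phi^-1(T_s h))], where V(k, y) is the noise
   stability of the half-space {z <= y} and k(s) corresponds to the correlation
   (rho - s^2) / (1 - s^2). Then psi(0) = Lambda_rho(E h) and psi(r) = Stab_rho(h),
   so it suffices to bound psi' from above.
   Integrating by parts on the cube, psi'(s) is at most s times the expectation of
   V_xx(T_s h) (|grad|^2 - I(T_s h)^2 / (1 - s^2)), up to third order terms, where I
   is the Gaussian isoperimetric profile and grad the gradient of the multilinear
   extension of h at s x. The level-1 inequality for the product measure with mean
   s x says that |grad|^2 <= I(T_s h)^2 / (1 - s^2) up to third order terms too; it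
   is proved by Lindeberg replacement. Since s^2 <= rho < 1, part of the noise can be
   spent on hypercontractivity, which bounds the sum of the cubes of the partial
   derivatives by a power of the maximal influence. V_xx blows up at 0 and 1, hence
   h = eps + (1 - 2 eps) g. *)

Set Implicit Arguments.
Unset Strict Implicit.
Unset Printing Implicit Defensive.

(** * Calculus of derivatives *)

(** Influences are controlled only one at a time, so every error has to be summable over the n
    coordinates. All cubic errors are brought to the sum of E|[pder]|^3: two of the three powers are
    summed over i by Bessel's inequality, uniformly in n, and the remaining one yields a power of
    kappa. The level-1 inequality is used pointwise and with its sharp constant, because its leading
    term must cancel exactly against the term produced by k'(s); only the remainder may be lossy.
    The constants come from e = kappa^((1 - rho)/27), for 0 < kappa < 1. With eps = e/4 the bound on
    V_xx is of order 1/e and its Lipschitz constant of order 1/e^2; smoothing the level-1 inequality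
    at scale t = e costs t^2. The sum of cubes is at most 2 e^6/(1 - rho), so the errors are of
    order e, e^3 and e^4, over 1 - rho. Hypercontractivity gives kappa the power (1 - rho)/(2(1 +
    rho)), that is e^(27/(2(1 + rho))), and 27/4 >= 6. Identities and inequalities between integrals
    over a half-line are obtained by comparing derivatives in the endpoint and limits at -oo. *)

Section deriv.
Context {R : realType}.
Implicit Types (f g : R -> R) (x y a b c : R).

Lemma derD f g x a b : is_derive x 1 f a -> is_derive x 1 g b ->
  is_derive x 1 (fun y => f y + g y) (a + b).
Proof. by move=> fa gb; exact: is_deriveD. Qed.

Lemma derN f x a : is_derive x 1 f a -> is_derive x 1 (fun y => - f y) (- a).
Proof. by move=> fa; exact: is_deriveN. Qed.

Lemma derB f g x a b : is_derive x 1 f a -> is_derive x 1 g b ->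
  is_derive x 1 (fun y => f y - g y) (a - b).
Proof. by move=> fa gb; exact: is_deriveB. Qed.

Lemma derM f g x a b : is_derive x 1 f a -> is_derive x 1 g b ->
  is_derive x 1 (fun y => f y * g y) (a * g x + f x * b).
Proof.
move=> fa gb; have := is_deriveM fa gb.
by move/is_derive_eq; apply; rewrite addrC mulrC; congr (_ + _); rewrite mulrC.
Qed.

Lemma der_cst c x : is_derive x 1 (fun _ : R => c) 0.
Proof. exact: is_derive_cst. Qed.

Lemma der_id x : is_derive x 1 (fun y : R => y) 1.
Proof. exact: is_derive_id. Qed.

Lemma der_comp f g x a b : is_derive (g x) 1 f a -> is_derive x 1 g b ->
  is_derive x 1 (fun y => f (g y)) (a * b).
Proof. by move=> fa gb; exact: is_derive1_comp. Qed.

Lemma derZ c f x a : is_derive x 1 f a ->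
  is_derive x 1 (fun y => c * f y) (c * a).
Proof. by move=> fa; apply: is_derive_eq (derM (der_cst c x) fa) _; rewrite mul0r add0r. Qed.

Lemma der_sum (I : finType) (f : I -> R -> R) (df : I -> R) x :
  (forall i, is_derive x 1 (f i) (df i)) ->
  is_derive x 1 (fun y => \sum_i f i y) (\sum_i df i).
Proof.
move=> fd; elim: (index_enum I) => [|i r IH].
  by under eq_fun do rewrite big_nil; rewrite big_nil; exact: der_cst.
by under eq_fun do rewrite big_cons; rewrite big_cons; exact: derD.
Qed.

Lemma der_eq f x a b : is_derive x 1 f a -> a = b -> is_derive x 1 f b.
Proof. by move=> fa <-. Qed.

Lemma der_continuous f x a : is_derive x 1 f a -> {for x, continuous f}.
Proof.
by move=> fa; apply/differentiable_continuous/derivable1_diffP; case: fa.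
Qed.

Lemma mvt f df a b : a <= b -> (forall x, a <= x <= b -> is_derive x 1 f (df x)) ->
  exists c, a <= c <= b /\ f b - f a = df c * (b - a).
Proof.
move=> ab fd; have [||c cab ->] := @MVT_segment R f df a b ab.
- by move=> x; rewrite in_itv/= => /andP[? ?]; apply: fd; rewrite !ltW.
- apply: continuous_in_subspaceT => x; rewrite inE/= in_itv/= => /fd.
  exact: der_continuous.
- by exists c; split.
Qed.

Lemma der_homo f df a b : a <= b ->
  (forall x, a <= x <= b -> is_derive x 1 f (df x)) ->
  (forall x, a <= x <= b -> 0 <= df x) -> f a <= f b.
Proof.
move=> ab fd df0; have [c [cab e]] := mvt ab fd.
by rewrite -subr_ge0 e mulr_ge0 ?df0// subr_ge0.
Qed.

Lemma mvt_le f df a b M : a <= b ->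
  (forall x, a <= x <= b -> is_derive x 1 f (df x)) ->
  (forall x, a <= x <= b -> df x <= M) -> f b - f a <= M * (b - a).
Proof.
move=> ab fd df0; have [c [cab ->]] := mvt ab fd.
by rewrite ler_wpM2r ?df0// subr_ge0.
Qed.

Lemma mvt_norm f df a b M :
  (forall x, Num.min a b <= x <= Num.max a b -> is_derive x 1 f (df x)) ->
  (forall x, Num.min a b <= x <= Num.max a b -> `|df x| <= M) ->
  `|f b - f a| <= M * `|b - a|.
Proof.
wlog ab : a b / a <= b.
  move=> H; case/orP: (le_total a b) => [|ba]; first exact: H.
  by rewrite minC maxC distrC (distrC b); exact: H.
rewrite min_l// max_r// => fd dfM; have [c [cab ->]] := mvt ab fd.
by rewrite normrM ler_wpM2r ?dfM.
Qed.

(** A nondecreasing function that tends to 0 at -oo cannot be negative. This is how integrals over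
    []-oo, x]] are compared below. *)
Lemma ge0_at_Ny f df x : (forall z, z <= x -> is_derive z 1 f (df z)) ->
  (forall z, z <= x -> 0 <= df z) ->
  (f z @[z --> -oo] --> (0:R))%classic -> 0 <= f x.
Proof.
move=> fd df0 f0; rewrite leNgt; apply/negP => fx0.
have /cvgrPdist_lt /(_ (- f x)) := f0; rewrite oppr_gt0 => /(_ fx0).
move=> fy; near (ninfty_nbhs R)%R => y.
have yx : y <= x by near: y; apply: nbhs_ninfty_le; exact: num_real.
have : `|0 - f y| < - f x by near: y.
rewrite sub0r normrN; have : f y <= f x.
  by apply: (der_homo yx) => z /andP[_ zx]; [exact: fd|exact: df0].
by have := ler_norm (- f y); rewrite normrN; lra.
Unshelve. all: by end_near. Qed.

Lemma between_norm a b x :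
  Num.min a b <= x <= Num.max a b -> `|x - a| <= `|b - a|.
Proof.
case/orP: (le_total a b) => ab.
  rewrite min_l// max_r// => /andP[? ?].
  by rewrite !ger0_norm; lra.
rewrite min_r// max_l// => /andP[? ?].
by rewrite !ler0_norm; lra.
Qed.

(** The mean value theorem is applied to f minus its tangent; this loses the factor 1/2 of the sharp
    constant, which is harmless. *)
Lemma taylor1 f (df : R -> R) L a b : (forall x, is_derive x 1 f (df x)) ->
  (forall x, `|df x - df a| <= L * `|x - a|) ->
  `|f b - f a - df a * (b - a)| <= L * (b - a) ^+ 2.
Proof.
move=> fd dfL; have L0 : 0 <= L.
  by have := dfL (a + 1); rewrite addrAC subrr add0r normr1 mulr1; apply: le_trans.
have -> : f b - f a - df a * (b - a) =
  (f b - df a * b) - (f a - df a * a) by ring.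
rewrite -(real_normK (num_real (b - a))) expr2 mulrA.
apply: (@mvt_norm (fun x => f x - df a * x) (fun x => df x - df a)).
  by move=> x _; apply: der_eq; rewrite /GRing.scale/=; lra.
by move=> x /between_norm xab; rewrite (le_trans (dfL x))// ler_wpM2l.
Qed.

Lemma taylor2 f (df : R -> R) ddf L a b : (forall x, is_derive x 1 f (df x)) ->
  (forall x, is_derive x 1 df (ddf x)) ->
  (forall x, `|ddf x - ddf a| <= L * `|x - a|) ->
  `|f b - f a - df a * (b - a) - ddf a / 2 * (b - a) ^+ 2| <= L * `|b - a| ^+ 3.
Proof.
move=> fd dfd dfL; have L0 : 0 <= L.
  by have := dfL (a + 1); rewrite addrAC subrr add0r normr1 mulr1; apply: le_trans.
pose g x := f x - df a * x - ddf a / 2 * (x - a) ^+ 2.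
have -> : f b - f a - df a * (b - a) - ddf a / 2 * (b - a) ^+ 2 = g b - g a.
  by rewrite /g; ring.
rewrite exprSr mulrA (real_normK (num_real _)).
apply: (@mvt_norm g (fun x => df x - df a - ddf a * (x - a))).
  by move=> x _; apply: der_eq; rewrite /GRing.scale/=; lra.
move=> x /between_norm xab; rewrite (le_trans (taylor1 _ dfd dfL))// ler_wpM2l//.
rewrite -(real_normK (num_real (x - a))) -(real_normK (num_real (b - a))).
by rewrite lerXn2r// nnegrE.
Qed.

(** By Caratheodory's criterion the increments of u and v are multiples of t - s by factors
    continuous at s, so the difference quotient of f is O(|t - s|). *)
Lemma der_quadratic f (u v : R -> R) (C s du dv : R) :
  is_derive s 1 u du -> is_derive s 1 v dv ->
  (forall t, `|f t - f s| <= C * ((u t - u s) ^+ 2 + (v t - v s) ^+ 2)) ->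
  is_derive s 1 f 0.
Proof.
move=> /is_derive1_caratheodory[gu [ue gu_c _]].
move=> /is_derive1_caratheodory[gv [ve gv_c _]] fC.
apply/is_derive1_caratheodory.
pose g t := if t == s then 0 else (f t - f s) / (t - s).
have gs : g s = 0 by rewrite /g eqxx.
exists g; split => //.
- move=> z; rewrite /g; case: eqP => [->|/eqP]; first by rewrite !subrr mulr0.
  by rewrite -subr_eq0 => /divfK->.
- suff h : (g t @[t --> s] --> (0:R))%classic by move: h; rewrite -gs.
  apply/norm_cvg0P.
  apply: (@squeeze_cvgr _ _ _ _ (cst 0)
    (fun t => C * (gu t ^+ 2 + gv t ^+ 2) * `|t - s|)).
  + near=> t; rewrite normr_ge0/= /g; case: eqP => [->|/eqP ts].
      by rewrite normr0 subrr normr0 mulr0.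
    rewrite normrM normfV ler_pdivrMr ?normr_gt0 ?subr_eq0//.
    apply: (le_trans (fC t)).
    rewrite -[leRHS]mulrA -expr2 (real_normK (num_real _)) ue ve; lra.
  + exact: cvg_cst.
  + rewrite -[X in (_ --> X)%classic](mulr0 (C * (gu s ^+ 2 + gv s ^+ 2))).
    apply: cvgM.
      apply: cvgM; first exact: cvg_cst.
      by apply: cvgD; rewrite !expr2; apply: cvgM.
    have : (`|t - s| @[t --> s] --> `|s - s|)%classic.
      by apply: cvg_norm; apply: cvgB; [exact: cvg_id|exact: cvg_cst].
    by rewrite subrr normr0.
Unshelve. all: by end_near. Qed.

(** Chain rule in two variables, with the differentiability of F at one point expressed by a
    quadratic remainder. It serves for [V] along the flow and for the bivariate Gaussian law on the
    diagonal. *)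
Lemma der_comp2 (F : R -> R -> R) (A B C : R) (u v : R -> R) (s du dv : R) :
  is_derive s 1 u du -> is_derive s 1 v dv ->
  (forall k y, `|F k y - F (u s) (v s) - A * (k - u s) - B * (y - v s)| <=
    C * ((k - u s) ^+ 2 + (y - v s) ^+ 2)) ->
  is_derive s 1 (fun t => F (u t) (v t)) (A * du + B * dv).
Proof.
move=> ud vd FC; pose f t := F (u t) (v t) - A * u t - B * v t.
have fd : is_derive s 1 f 0.
  apply: (der_quadratic ud vd (C := C)) => t.
  rewrite (_ : f t - f s = F (u t) (v t) - F (u s) (v s) - A * (u t - u s) -
    B * (v t - v s)); first exact: FC.
  by rewrite /f; ring.
rewrite (_ : (fun t => _) = fun t => f t + A * u t + B * v t); last first.
  by apply/funext => t; rewrite /f; ring.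
by apply: der_eq; rewrite /GRing.scale/=; lra.
Qed.

End deriv.

(** * The standard Gaussian law *)

Section gauss.
Context {R : realType}.
Implicit Types (x y a b c k : R).
Local Notation mu := (@lebesgue_measure R).

Definition phi x : R := normal_pdf 0 1 x.

Lemma phiE x : phi x = normal_peak 1 * expR (- (x ^+ 2 / 2)).
Proof.
rewrite /phi normal_pdfE ?oner_eq0// /normal_fun subr0 expr1n mulNr.
by congr (_ * expR (- (_ / _))); rewrite -mulr_natl mulr1.
Qed.

Lemma phi_gt0 x : 0 < phi x.
Proof. by rewrite phiE mulr_gt0 ?expR_gt0// normal_peak_gt0// oner_eq0. Qed.

Lemma phi_ge0 x : 0 <= phi x.
Proof. exact: ltW (phi_gt0 x). Qed.

Lemma peak_le1 : normal_peak 1 <= 1 :> R.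
Proof.
rewrite /normal_peak invf_le1 ?sqrtr_gt0; last first.
  by rewrite expr1n mul1r mulrn_wgt0// pi_gt0.
rewrite -[leLHS]sqrtr1 ler_wsqrtr// expr1n mul1r.
by have := @pi_ge2 R; rewrite -mulr_natl; lra.
Qed.

Lemma phi_le1 x : phi x <= 1.
Proof. by rewrite (le_trans (normal_pdf_ub _ _ _)) ?oner_eq0// peak_le1. Qed.

Lemma phiN x : phi (- x) = phi x.
Proof. by rewrite !phiE sqrrN. Qed.

Lemma sqr_phi_le2 x : x ^+ 2 * phi x <= 2.
Proof.
rewrite phiE mulrA (mulrC _ (normal_peak _)) -mulrA.
have e0 := expR_gt0 (- (x ^+ 2 / 2)).
have h : x ^+ 2 * expR (- (x ^+ 2 / 2)) <= 2.
  rewrite expRN ler_pdivrMr ?expR_gt0//.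
  by have := expR_ge1Dx (x ^+ 2 / 2); lra.
have := peak_le1; have := normal_peak_ge0 (1:R).
have : 0 <= x ^+ 2 * expR (- (x ^+ 2 / 2)) by rewrite mulr_ge0 ?sqr_ge0// ltW.
nra.
Qed.

Lemma norm_phi_le1 x : `|x * phi x| <= 1.
Proof.
rewrite normrM (gtr0_norm (phi_gt0 x)) phiE.
have h : `|x| * expR (- (x ^+ 2 / 2)) <= 1.
  rewrite expRN ler_pdivrMr ?expR_gt0// mul1r.
  apply: le_trans (expR_ge1Dx _); rewrite -(real_normK (num_real x)).
  have : 0 <= (`|x| - 1) ^+ 2 by rewrite sqr_ge0.
  by rewrite sqrrB expr1n mulr1; lra.
rewrite mulrCA mulr_ile1// ?normal_peak_ge0 ?peak_le1//.
Qed.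

Lemma der_phi x : is_derive x 1 phi (- x * phi x).
Proof.
rewrite (_ : phi = fun y => normal_peak 1 * expR (- (2^-1 * y ^+ 2))); last first.
  by apply/funext => y; rewrite phiE (mulrC 2^-1).
apply: der_eq; rewrite /GRing.scale/=; lra.
Qed.
#[local] Existing Instance der_phi.

Lemma phi_cont : continuous phi.
Proof. by apply: continuous_normal_pdf; rewrite oner_eq0. Qed.

Definition int_Ny (f : R -> R) y := (\int[mu]_(t in `]-oo, y]) f t)%R.

Lemma integrable_phi (A : set (measurableTypeR R)) : measurable A -> mu.-integrable A (EFin \o phi).
Proof.
by move=> mA; apply: (integrableS _ _ (@subsetT _ _)) => //; exact: integrable_normal_pdf.
Qed.

Lemma PhiE : @Phi R = int_Ny phi.
Proof. by []. Qed.

Section dominated.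
Variables (f : R -> R) (C : R).
Hypotheses (cf : continuous f) (f0 : forall x, 0 <= f x)
  (fC : forall x, f x <= C * phi x).

Lemma integrable_Cphi (A : set (measurableTypeR R)) : measurable A ->
  mu.-integrable A (EFin \o (fun x => C * phi x)).
Proof.
move=> mA; have := integrableZl mA C (integrable_phi mA).
exact.
Qed.

Lemma dom_integrable (A : set (measurableTypeR R)) : measurable A -> mu.-integrable A (EFin \o f).
Proof.
move=> mA; apply: (le_integrable mA _ _ (integrable_Cphi mA)).
- apply/measurable_EFinP; apply: measurable_funTS; exact: continuous_measurable_fun.
- move=> x _ /=; rewrite lee_fin ger0_norm// (le_trans (fC x))// ler_norm//.
Qed.

Lemma der_int_Ny x : is_derive x 1 (int_Ny f) (f x).
Proof.
have [||||d1 d2] := @continuous_FTC1 R f -oo%O x (x + 1).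
- by rewrite ltrDl.
- exact: dom_integrable.
- exact: ltNyr.
- exact: cf.
- by split => //; rewrite -derive1E.
Qed.

Lemma int_Ny_ge0 x : 0 <= int_Ny f x.
Proof. by apply: Rintegral_ge0 => ? _. Qed.

Lemma int_Ny_le x : int_Ny f x <= C * Phi x.
Proof.
rewrite PhiE /int_Ny -RintegralZl//; last exact: integrable_phi.
apply: le_Rintegral => //; first exact: dom_integrable.
exact: integrable_Cphi.
Qed.

End dominated.

Lemma der_Phi x : is_derive x 1 (@Phi R) (phi x).
Proof.
rewrite PhiE; apply: (@der_int_Ny _ 1) => //.
- exact: phi_cont.
- by move=> y; rewrite phi_ge0.
- by move=> y; rewrite mul1r.
Qed.

#[local] Existing Instance der_Phi.

Lemma Phi_ge0 x : 0 <= Phi x.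
Proof. by rewrite PhiE; apply: int_Ny_ge0 => y; rewrite phi_ge0. Qed.


(** A random variable whose cdf is [Phi], so that the general limits of a cdf at both infinities
    apply. *)
Definition idRV : measurableTypeR R -> R := idfun.
HB.instance Definition _ :=
  @isMeasurableFun.Build _ _ _ _ idRV (@measurable_id _ _ setT).

Lemma Phi_fin x : normal_prob 0 1 `]-oo, x]%classic = (Phi x)%:E.
Proof. by rewrite /Phi fineK// fin_num_measure. Qed.

Lemma cdf_idRV : cdf (idRV : {RV (normal_prob (0:R) 1) >-> R}) = EFin \o (@Phi R).
Proof. by apply/funext => x; rewrite /cdf /distribution /= -Phi_fin. Qed.

Lemma Phi_cvgNy : (Phi x @[x --> -oo] --> (0:R))%classic.
Proof.
have := cvg_cdfNy0 (idRV : {RV (normal_prob (0:R) 1) >-> R}); rewrite cdf_idRV.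
by move/fine_cvgP => [].
Qed.

Lemma Phi_cvgy : (Phi x @[x --> +oo] --> (1:R))%classic.
Proof.
have := cvg_cdfy1 (idRV : {RV (normal_prob (0:R) 1) >-> R}); rewrite cdf_idRV.
by move/fine_cvgP => [].
Qed.

Lemma Phi_le1 x : Phi x <= 1.
Proof. by rewrite -lee_fin -Phi_fin probability_le1. Qed.

Lemma le_Phi x y : x <= y -> Phi x <= Phi y.
Proof.
by move=> xy; apply: (der_homo xy (fun z _ => der_Phi z)) => z _; rewrite phi_ge0.
Qed.

Lemma lt_Phi x y : x < y -> Phi x < Phi y.
Proof.
move=> xy; have [c [_ e]] := mvt (ltW xy) (fun z _ => der_Phi z).
by rewrite -subr_gt0 e mulr_gt0 ?phi_gt0// subr_gt0.
Qed.

Lemma Phi_inj : injective (@Phi R).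
Proof.
move=> x y xy; apply/eqP; rewrite eq_le !leNgt; apply/andP; split.
  by apply/negP => /lt_Phi; rewrite xy ltxx.
by apply/negP => /lt_Phi; rewrite xy ltxx.
Qed.

(** [Phi y + Phi (- y)] has zero derivative because [phi] is even, and its limit at -oo is 1. *)
Lemma PhiN x : Phi (- x) = 1 - Phi x.
Proof.
have h y : is_derive y 1 (fun y => Phi y + Phi (- y)) 0.
  by apply: der_eq; rewrite phiN mulrN1 subrr.
suff : Phi x + Phi (- x) = 1 by lra.
have e : (fun y => Phi y + Phi (- y)) = cst (Phi x + Phi (- x)).
  by apply/funext => y; exact: (is_derive_0_is_cst y x h).
have : ((Phi y + Phi (- y)) @[y --> -oo] --> (0 + 1 : R))%classic.
  apply: cvgD; [exact: Phi_cvgNy|rewrite cvgNy_compNP/=].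
  by under eq_cvg do rewrite /= opprK; exact: Phi_cvgy.
rewrite e add0r => l1.
exact: (cvg_unique (@norm_hausdorff _ _) (cvg_cst _) l1).
Qed.

Lemma tail_cvg : ((Phi x + phi x + `|x * phi x|) @[x --> -oo] --> (0:R))%classic.
Proof.
apply/cvgrPdist_le => e e0; have /cvgrPdist_le /(_ (e/2)) := Phi_cvgNy.
rewrite divr_gt0// => /(_ isT) h; near=> x.
have hx : `|0 - Phi x| <= e / 2 by near: x.
move: hx; rewrite !sub0r !normrN ger0_norm ?Phi_ge0// ger0_norm; last first.
  by rewrite !addr_ge0// ?Phi_ge0// phi_ge0.
have xl : x <= -1 by near: x; apply: nbhs_ninfty_le; exact: num_real.
(* Since x^2 phi(x) <= 2, this makes |x phi(x)| at most e/4; then phi(x) <= e/4 too, because x <=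
   -1. *)
have xe : x <= - (8 / e) by near: x; apply: nbhs_ninfty_le; exact: num_real.
have := sqr_phi_le2 x; have := phi_gt0 x; set p := phi x => p0 xp Phie.
rewrite normrM (gtr0_norm p0) ler0_norm; last by lra.
have xe8 : 8 <= - x * e by rewrite -ler_pdivrMr//; lra.
have xp0 : 0 <= - x * p by rewrite mulr_ge0//; lra.
have h1 : - x * p * 8 <= - x * p * (- x * e) by rewrite ler_wpM2l.
have h2 : x ^+ 2 * p * e <= 2 * e by rewrite ler_wpM2r// ltW.
have h3 : p <= - x * p by apply: ler_peMl; [exact: ltW|lra].
have h4 : - x * p * (- x * e) = x ^+ 2 * p * e by ring.
lra.
Unshelve. all: by end_near. Qed.

(** A common envelope, vanishing at -oo, for expressions built from [Phi z], [phi z] and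
    [z * phi z]: a bound by a multiple of it replaces a computation of limits. *)
Definition tail x := Phi x + phi x + `|x * phi x|.

Lemma ge0_tail (f df : R -> R) C x :
  (forall z, z <= x -> is_derive z 1 f (df z)) ->
  (forall z, z <= x -> 0 <= df z) ->
  (forall z, z <= x -> `|f z| <= C * tail z) -> 0 <= f x.
Proof.
move=> fd df0 fC; apply: (ge0_at_Ny fd df0).
apply/norm_cvg0P; apply: (@squeeze_cvgr _ _ _ _ (cst 0) (fun z => C * tail z)).
- near=> z; have zx : z <= x by near: z; apply: nbhs_ninfty_le; exact: num_real.
  by rewrite normr_ge0 fC.
- exact: cvg_cst.
- by have := cvgM (cvg_cst C) tail_cvg; rewrite mulr0; apply.
Unshelve. all: by end_near. Qed.

Lemma tail_ge x : [/\ 0 <= Phi x, Phi x <= tail x, phi x <= tail x & `|x * phi x| <= tail x].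
Proof.
rewrite /tail; have := Phi_ge0 x; have := phi_gt0 x.
by have := normr_ge0 (x * phi x); split; lra.
Qed.

(** The quantity is E[(x + G)^+] for a standard Gaussian G. With the factor x frozen, the derivative
    in z is (x - z) phi(z), nonnegative to the left of x. *)
Lemma mills x : 0 <= phi x + x * Phi x.
Proof.
apply: (@ge0_tail (fun z => phi z + x * Phi z) (fun z => - z * phi z + x * phi z) (1 + `|x|)).
- by move=> z zx; rewrite -mulrDl mulr_ge0 ?phi_ge0//; lra.
- move=> z _; have [a b c d] := tail_ge z.
  rewrite mulrDl mul1r; apply: (le_trans (ler_normD _ _)); apply: lerD.
    by rewrite gtr0_norm// phi_gt0.
  by rewrite normrM ler_wpM2l// ger0_norm.
Qed.

Lemma phi_le_neg x y : x <= y -> y <= 0 -> phi x <= phi y.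
Proof.
move=> xy y0; apply: (der_homo xy (fun z _ => der_phi z)) => z /andP[_ zy].
by rewrite mulr_ge0 ?phi_ge0//; lra.
Qed.

(** A lower bound for the isoperimetric profile. For x <= -1, [mills] gives phi(x) >= Phi(x); on
    [-1, 0] monotonicity gives phi(x) >= phi(1); the rest is symmetry. *)
Lemma phi_lb x : phi 1 * (Phi x * (1 - Phi x)) <= phi x.
Proof.
wlog x0 : x / x <= 0.
  move=> H; have [x0|/ltW x0] := leP x 0; first exact: H.
  by have := H (- x); rewrite PhiN phiN oppr_le0 => /(_ x0); lra.
have := Phi_ge0 x; have := Phi_le1 x; have := mills x; have := phi_gt0 x.
have := phi_gt0 1; have := phi_le1 1.
have [x1|/ltW x1] := leP x (-1); first by nra.
by have := phi_le_neg x1 x0; rewrite phiN; nra.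
Qed.

Lemma Phi_surj a : 0 < a < 1 -> exists x, Phi x = a.
Proof.
move=> /andP[a0 a1].
have [x xa] : exists x, Phi x <= a.
  have /cvgrPdist_lt /(_ a a0) h := Phi_cvgNy.
  near (ninfty_nbhs R)%R => x; exists x.
  have : `|0 - Phi x| < a by near: x.
  by rewrite sub0r normrN ger0_norm ?Phi_ge0// => /ltW.
have [y ya] : exists y, a <= Phi y.
  have /cvgrPdist_lt /(_ (1 - a)) := Phi_cvgy; rewrite subr_gt0 => /(_ a1) h.
  near (pinfty_nbhs R)%R => y; exists y.
  have : `|1 - Phi y| < 1 - a by near: y.
  by rewrite ger0_norm ?subr_ge0 ?Phi_le1//; lra.
have xy : x <= y.
  rewrite leNgt; apply/negP => /lt_Phi; lra.
have [||c _ ca] := @IVT R (@Phi R) x y a xy.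
- apply: continuous_subspaceT => z; exact: der_continuous (der_Phi z).
- by rewrite min_l ?max_r ?le_Phi// xa ya.
- by exists c.
Unshelve. all: by end_near. Qed.

Lemma Phi_invK a : 0 < a < 1 -> Phi (Phi_inv a) = a.
Proof.
move=> /Phi_surj [x xa]; rewrite /Phi_inv.
by case: xgetP => [y -> //|/(_ x)] /=.
Qed.

Lemma Phi_gt0 x : 0 < Phi x.
Proof. by rewrite (le_lt_trans (Phi_ge0 (x - 1)))// lt_Phi// ltrBlDr ltrDl. Qed.

Lemma Phi_lt1 x : Phi x < 1.
Proof. by rewrite (lt_le_trans _ (Phi_le1 (x + 1)))// lt_Phi// ltrDl. Qed.

Lemma PhiK x : Phi_inv (Phi x) = x.
Proof. by apply: Phi_inj; rewrite Phi_invK// Phi_gt0 Phi_lt1. Qed.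

Lemma der_Phi_inv a : 0 < a < 1 ->
  is_derive a 1 (@Phi_inv R) (phi (Phi_inv a))^-1.
Proof.
move=> a01; rewrite -{1}(Phi_invK a01).
apply: (@is_derive_inverse R (@Phi R)).
- by near=> x; exact: PhiK.
- by near=> x; exact: der_continuous (der_Phi x).
- by rewrite gt_eqF// phi_gt0.
Unshelve. all: by end_near. Qed.

End gauss.

(** * Gaussian noise stability of half-spaces *)

Section V.
Context {R : realType}.
Implicit Types (x y a b c k : R).
#[local] Existing Instance der_phi.
#[local] Existing Instance der_Phi.

Lemma Phi_lip a b : `|Phi b - Phi a| <= `|b - a| :> R.
Proof.
rewrite -[leRHS]mul1r; apply: mvt_norm => z _.
by rewrite gtr0_norm ?phi_gt0// phi_le1.
Qed.

Lemma phi_lip a b : `|phi b - phi a| <= `|b - a| :> R.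
Proof.
rewrite -[leRHS]mul1r; apply: mvt_norm => z _.
by rewrite mulNr normrN norm_phi_le1.
Qed.

Lemma Phi_taylor a b : `|Phi b - Phi a - phi a * (b - a)| <= (b - a) ^+ 2 :> R.
Proof.
rewrite -[leRHS]mul1r; apply: taylor1 => x.
by rewrite mul1r phi_lip.
Qed.

(* V k (Phi_inv a) is the stability of a half-space of Gaussian measure a under
   noise of correlation (1 - k ^+ 2) / (1 + k ^+ 2), see LambdaE. *)
Definition V : R -> R -> R :=
  locked (fun k y => 2 * int_Ny (fun z => Phi (k * z) * phi z) y).

Lemma VE k y : V k y = 2 * int_Ny (fun z => Phi (k * z) * phi z) y.
Proof. by rewrite /V -lock. Qed.

Lemma V_dom k : [/\ continuous (fun z => Phi (k * z) * phi z),
  forall x, 0 <= Phi (k * x) * phi x & forall x, Phi (k * x) * phi x <= 1 * phi x].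
Proof.
split=> x.
- by apply: der_continuous; apply: der_eq.
- by rewrite mulr_ge0 ?Phi_ge0 ?phi_ge0.
- by rewrite ler_wpM2r ?phi_ge0 ?Phi_le1.
Qed.

Lemma der_V k y : is_derive y 1 (V k) (2 * Phi (k * y) * phi y).
Proof.
have [c g0 g1] := V_dom k; have d := der_int_Ny c g0 g1 y.
rewrite (_ : V k = fun y => 2 * int_Ny (fun z => Phi (k * z) * phi z) y).
  by apply: (der_eq (derZ 2 d)); rewrite mulrA.
by apply/funext => z; rewrite VE.
Qed.
#[local] Existing Instance der_V.

Lemma V_ge0 k y : 0 <= V k y.
Proof.
rewrite VE; have [c g0 g1] := V_dom k; rewrite mulr_ge0//; exact: int_Ny_ge0.
Qed.

Lemma V_le k y : V k y <= 2 * Phi y.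
Proof.
rewrite VE; have [c g0 g1] := V_dom k.
by rewrite ler_wpM2l// (le_trans (int_Ny_le c g0 g1 y))// mul1r.
Qed.


(** Both [V k] and 2 Phi - [V k] are nondecreasing, because the integrand of [V] carries a factor
    between 0 and 1. In terms of the measure of the half-space, [V k] is thus 2-Lipschitz. *)
Lemma V_lip k x y : `|V k y - V k x| <= 2 * `|Phi y - Phi x|.
Proof.
wlog xy : x y / x <= y.
  move=> H; case/orP: (le_total x y) => [|xy]; first exact: H.
  by rewrite distrC (distrC (Phi y)); exact: H.
have V1 : V k x <= V k y.
  apply: (der_homo xy (fun z _ => der_V k z)) => z _.
  by rewrite !mulr_ge0 ?Phi_ge0 ?phi_ge0.
have d (z : R) : is_derive z 1 (fun z => 2 * Phi z - V k z)
    (2 * phi z - 2 * Phi (k * z) * phi z).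
  exact: derB (derZ 2 (der_Phi z)) (der_V k z).
have := der_homo xy (fun z _ => d z) => h.
have {}h : 2 * Phi x - V k x <= 2 * Phi y - V k y.
  by apply: h => z _; have := Phi_le1 (k * z); have := phi_ge0 z; nra.
by have := le_Phi xy => ?; rewrite !ger0_norm; lra.
Qed.

(** The slope k = 1 is correlation 0, that is independence. Both sides have the same derivative and
    vanish at -oo. *)
Lemma V1E y : V 1 y = Phi y ^+ 2.
Proof.
have d (z : R) : is_derive z 1 (fun z => V 1 z - Phi z ^+ 2) 0.
  by apply: der_eq; rewrite /GRing.scale/= mul1r; lra.
have bd z : `|V 1 z - Phi z ^+ 2| <= 3 * tail z.
  have [? ? _ _] := tail_ge z; have := V_ge0 1 z; have := V_le 1 z.
  have := Phi_le1 z; have : 0 <= Phi z ^+ 2 by rewrite sqr_ge0.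
  by rewrite ler_norml; nra.
have h1 : 0 <= V 1 y - Phi y ^+ 2.
  exact: (@ge0_tail _ (fun z => V 1 z - Phi z ^+ 2) (fun=> 0) 3 y (fun z _ => d z) (fun=> fun=> lexx 0) (fun z _ => bd z)).
have d' (z : R) : is_derive z 1 (fun z => - (V 1 z - Phi z ^+ 2)) 0.
  by rewrite -oppr0; exact: derN (d z).
have bd' z : `|- (V 1 z - Phi z ^+ 2)| <= 3 * tail z by rewrite normrN.
have h2 : 0 <= - (V 1 y - Phi y ^+ 2).
  exact: (@ge0_tail _ (fun z => - (V 1 z - Phi z ^+ 2)) (fun=> 0) 3 y (fun z _ => d' z) (fun=> fun=> lexx 0) (fun z _ => bd' z)).
lra.
Qed.

(** The partial derivative of [V] in k: twice the integral of z phi(k z) phi(z) over []-oo, y]], in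
    closed form. *)
Definition Vk k y : R := - 2 * phi (k * y) * phi y / (1 + k ^+ 2).

Lemma der_Vk k y : is_derive y 1 (Vk k) (2 * y * phi (k * y) * phi y).
Proof.
have k0 : 1 + k ^+ 2 != 0 by rewrite gt_eqF// ltr_wpDr// sqr_ge0.
by apply: der_eq; rewrite /GRing.scale/=; field.
Qed.

Lemma Vk_lip k x y : `|Vk k y - Vk k x| <= 2 * `|y - x|.
Proof.
apply: (mvt_norm (fun z _ => der_Vk k z)) => z _.
have := norm_phi_le1 z; have := phi_le1 (k * z); have := phi_ge0 (k * z).
rewrite (_ : 2 * z * _ * _ = 2 * phi (k * z) * (z * phi z)); last by ring.
by rewrite !normrM (ger0_norm (phi_ge0 (k * z))) normr_nat; have := normr_ge0 (z * phi z); rewrite normrM; nra.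
Qed.

(* The difference vanishes at y = -oo, and its derivative in y is a first order
   Taylor remainder of Phi. *)
Lemma V_incr k k' y :
  `|V k' y - V k y - Vk k y * (k' - k)| <= 6 * (k' - k) ^+ 2.
Proof.
(* Phi(z) - z phi(z) is the antiderivative of z^2 phi(z) that vanishes at -oo; z^2 appears because
   k' z and k z differ by (k' - k) z. *)
pose Q z := 2 * (k' - k) ^+ 2 * (Phi z - z * phi z).
pose Er z := V k' z - V k z - Vk k z * (k' - k).
pose dEr z := 2 * (Phi (k' * z) - Phi (k * z) - phi (k * z) * (k' * z - k * z)) * phi z.
have dEr' (z : R) : is_derive z 1 Er (dEr z).
  have := der_Vk k z => ?.
  by apply: der_eq; rewrite /dEr /GRing.scale/=; ring.
have dQ (z : R) : is_derive z 1 Q (2 * (k' - k) ^+ 2 * (z ^+ 2 * phi z)).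
  by apply: der_eq; rewrite /GRing.scale/=; ring.
have bd z : `|dEr z| <= 2 * (k' - k) ^+ 2 * (z ^+ 2 * phi z).
  rewrite /dEr normrM (ger0_norm (phi_ge0 z)) [leRHS]mulrA ler_wpM2r ?phi_ge0//.
  rewrite normrM normr_nat -mulrA ler_wpM2l//.
  by rewrite (le_trans (Phi_taylor _ _))// -mulrBl exprMn.
have tl z : `|Er z| + `|Q z| <= (4 + 2 * `|k' - k| + 4 * (k' - k) ^+ 2) * tail z.
  have [t1 t2 t3 t4] := tail_ge z.
  have a1 : `|V k' z - V k z| <= 4 * tail z.
    have := V_ge0 k z; have := V_le k z; have := V_ge0 k' z; have := V_le k' z.
    by rewrite ler_norml; lra.
  have a2 : `|Vk k z| <= 2 * tail z.
    rewrite /Vk mulNr mulNr mulNr normrN ger0_norm; last first.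
      by rewrite !mulr_ge0 ?phi_ge0// invr_ge0 addr_ge0// sqr_ge0.
    rewrite ler_pdivrMr ?ltr_wpDr ?sqr_ge0//.
    have := phi_le1 (k * z); have := phi_ge0 (k * z); have := phi_ge0 z.
    have : 0 <= k ^+ 2 by rewrite sqr_ge0.
    nra.
  have a3 : `|Er z| <= 4 * tail z + 2 * tail z * `|k' - k|.
    by rewrite (le_trans (ler_normB _ _))// normrM lerD// ler_wpM2r.
  have a4 : `|Q z| <= 2 * (k' - k) ^+ 2 * (2 * tail z).
    have q0 : 0 <= 2 * (k' - k) ^+ 2 by rewrite mulr_ge0 ?sqr_ge0.
    rewrite normrM (ger0_norm q0) ler_wpM2l// (le_trans (ler_normB _ _))//.
    by rewrite (ger0_norm (Phi_ge0 z)); lra.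
  lra.
have Qb : Q y <= 6 * (k' - k) ^+ 2.
  have := Phi_le1 y; have := norm_phi_le1 y; rewrite ler_norml => /andP[? _] ?.
  have := sqr_ge0 (k' - k); rewrite /Q; nra.
have b1 z : - dEr z <= 2 * (k' - k) ^+ 2 * (z ^+ 2 * phi z).
  by rewrite (le_trans _ (bd z))// -normrN ler_norm.
have b2 z : dEr z <= 2 * (k' - k) ^+ 2 * (z ^+ 2 * phi z).
  by rewrite (le_trans _ (bd z))// ler_norm.
have h1 : 0 <= Q y - Er y.
  apply: (@ge0_tail _ (fun z => Q z - Er z)
    (fun z => 2 * (k' - k) ^+ 2 * (z ^+ 2 * phi z) - dEr z)).
  - by move=> z _; have := b2 z; lra.
  - by move=> z _; apply: le_trans (tl z); rewrite (le_trans (ler_normB _ _))// addrC.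
have h2 : 0 <= Q y + Er y.
  apply: (@ge0_tail _ (fun z => Q z + Er z)
    (fun z => 2 * (k' - k) ^+ 2 * (z ^+ 2 * phi z) + dEr z)).
  - by move=> z _; have := b1 z; lra.
  - by move=> z _; apply: le_trans (tl z); rewrite (le_trans (ler_normD _ _))// addrC.
by rewrite -/(Er y) ler_norml; lra.
Qed.

(** The form required by [der_comp2]. The increment is split into one in k at y', one in y at k, and
    a mixed term bounded by the Lipschitz constant of [Vk] and 2ab <= a^2 + b^2. *)
Lemma V_quad k y k' y' :
  `|V k' y' - V k y - Vk k y * (k' - k) - 2 * Phi (k * y) * phi y * (y' - y)| <=
  (`|k| *+ 2 + 10) * ((k' - k) ^+ 2 + (y' - y) ^+ 2).
Proof.
have h1 := V_incr k k' y'.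
have h2 : `|(Vk k y' - Vk k y) * (k' - k)| <= (k' - k) ^+ 2 + (y' - y) ^+ 2.
  rewrite normrM; have := Vk_lip k y y'; have := normr_ge0 (k' - k).
  rewrite -(real_normK (num_real (k' - k))) -(real_normK (num_real (y' - y))).
  have := sqr_ge0 (`|k' - k| - `|y' - y|); nra.
have h3 : `|V k y' - V k y - 2 * Phi (k * y) * phi y * (y' - y)| <=
    (`|k| *+ 2 + 2) * (y' - y) ^+ 2.
  apply: (@taylor1 _ (V k) (fun y => 2 * Phi (k * y) * phi y)) => x.
  apply: (@mvt_norm _ (fun y => 2 * Phi (k * y) * phi y)
    (fun y => 2 * k * phi (k * y) * phi y - 2 * Phi (k * y) * (y * phi y))).
    by move=> z _; apply: der_eq; rewrite /GRing.scale/=; ring.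
  move=> z _; rewrite (le_trans (ler_normB _ _))//; apply: lerD.
    rewrite !normrM normr_nat !(ger0_norm (phi_ge0 _)) -mulrA -mulrA -[leRHS]mulr_natl.
    rewrite ler_wpM2l// ler_piMr//.
    by rewrite mulr_ile1 ?phi_ge0 ?phi_le1.
  rewrite !normrM normr_nat -mulrA ler_piMr// (ger0_norm (Phi_ge0 _)).
  by rewrite mulr_ile1 ?Phi_ge0 ?Phi_le1// -?normrM ?norm_phi_le1.
rewrite (_ : V k' y' - _ - _ - _ = (V k' y' - V k y' - Vk k y' * (k' - k)) +
  (Vk k y' - Vk k y) * (k' - k) + (V k y' - V k y - 2 * Phi (k * y) * phi y * (y' - y)));
  last by ring.
have h4 := ler_normD (V k' y' - V k y' - Vk k y' * (k' - k) + (Vk k y' - Vk k y) * (k' - k)) (V k y' - V k y - 2 * Phi (k * y) * phi y * (y' - y)).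
have h5 := ler_normD (V k' y' - V k y' - Vk k y' * (k' - k)) ((Vk k y' - Vk k y) * (k' - k)).
have h6 : 0 <= `|k| *+ 2 * (k' - k) ^+ 2 by rewrite mulr_ge0 ?sqr_ge0 ?mulrn_wge0.
have := sqr_ge0 (k' - k); have := sqr_ge0 (y' - y).
lra.
Qed.

End V.

(** * Trapezoid rule and smoothed positive part *)

Section W.
Context {R : realType}.
Implicit Types (x y a b c k e t g : R).
#[local] Existing Instance der_phi.
#[local] Existing Instance der_Phi.

Lemma phi_Phi_inv_lb x e : 0 < e -> e <= x <= 1 - e ->
  phi (1:R) * e / 2 <= phi (Phi_inv x).
Proof.
move=> e0 /andP[ex xe]; have x01 : 0 < x < 1 by apply/andP; split; lra.
have := phi_lb (Phi_inv x); rewrite Phi_invK//; apply: le_trans.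
by rewrite -mulrA ler_wpM2l ?phi_ge0//; nra.
Qed.

(* The first two derivatives of V k (Phi_inv x) in x. *)
Definition Vx k x : R := 2 * Phi (k * Phi_inv x).
Definition Vxx k x : R := 2 * k * phi (k * Phi_inv x) / phi (Phi_inv x).

Lemma Vxx_le k x e : 0 < e -> e <= x <= 1 - e -> 0 <= k <= 1 ->
  Vxx k x <= 4 / (phi (1:R) * e).
Proof.
move=> e0 ex /andP[k0 k1]; have p1 := phi_gt0 (1:R).
have h := phi_Phi_inv_lb e0 ex.
rewrite /Vxx ler_pdivrMr ?phi_gt0//.
rewrite (@le_trans _ _ 2)//.
  have := phi_le1 (k * Phi_inv x); have := phi_ge0 (k * Phi_inv x); nra.
rewrite (_ : 2 = 4 / (phi 1 * e) * (phi 1 * e / 2)); last first.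
  by field; rewrite !gt_eqF.
by rewrite ler_wpM2l// divr_ge0// mulr_ge0 ?phi_ge0// ltW.
Qed.

Lemma Vxx_ge0 k x : 0 <= k -> 0 <= Vxx k x.
Proof. by move=> k0; rewrite divr_ge0 ?mulr_ge0 ?phi_ge0. Qed.

Lemma der_Vx k x : 0 < x < 1 -> is_derive x 1 (Vx k) (Vxx k x).
Proof.
move=> x01; have d := der_Phi_inv x01.
by apply: der_eq; rewrite /Vxx /GRing.scale/=; field; rewrite gt_eqF// phi_gt0.
Qed.

Lemma der_Vxx k x : 0 < x < 1 -> is_derive x 1 (Vxx k)
  (2 * k * (1 - k ^+ 2) * Phi_inv x * phi (k * Phi_inv x) / phi (Phi_inv x) ^+ 2).
Proof.
move=> x01; have d := der_Phi_inv x01; have p0 := phi_gt0 (Phi_inv x).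
have d1 : is_derive x 1 (fun x => phi (Phi_inv x)) (- Phi_inv x).
  by apply: der_eq; rewrite mulNr; field; rewrite gt_eqF.
have p0' : phi (Phi_inv x) != 0 by rewrite gt_eqF.
have d2 := @is_deriveV R (fun x => phi (Phi_inv x)) x _ 1 p0' d1.
by apply: der_eq; rewrite /GRing.scale/=; field; rewrite gt_eqF.
Qed.

(** With y = [Phi_inv z], the derivative has denominator phi(y)^2 and a numerator of absolute value
    at most 2, because |u phi(u)| <= 1 at u = k y. *)
Lemma Vxx_lip k e a b : 0 < e -> e <= a <= 1 - e -> e <= b <= 1 - e ->
  0 <= k <= 1 -> `|Vxx k b - Vxx k a| <= 8 / (phi (1:R) * e) ^+ 2 * `|b - a|.
Proof.
move=> e0 ae be /andP[k0 k1]; have p1 := phi_gt0 (1:R).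
have ab z : Num.min a b <= z <= Num.max a b -> e <= z <= 1 - e.
  move: ae be => /andP[? ?] /andP[? ?]; case/orP: (le_total a b) => h.
    by rewrite min_l// max_r// => /andP[? ?]; apply/andP; split; lra.
  by rewrite min_r// max_l// => /andP[? ?]; apply/andP; split; lra.
have ab' z : Num.min a b <= z <= Num.max a b -> 0 < z < 1.
  by move=> /ab /andP[? ?]; apply/andP; split; lra.
apply: (mvt_norm (fun z hz => der_Vxx k (ab' z hz))) => z /ab ze.
set y := Phi_inv z; have h := phi_Phi_inv_lb e0 ze; have p0 := phi_gt0 y.
rewrite normrM normfV normrX (gtr0_norm p0) ler_pdivrMr ?exprn_gt0//.
rewrite (@le_trans _ _ 2)//.
  rewrite (_ : 2 * k * (1 - k ^+ 2) * y * _ =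
    2 * ((1 - k ^+ 2) * (k * y * phi (k * y)))); last by ring.
  rewrite !normrM normr_nat ler_piMr//.
  rewrite mulr_ile1 -?normrM ?norm_phi_le1//.
  by rewrite ger0_norm; nra.
rewrite (_ : 2 = 8 / (phi 1 * e) ^+ 2 * (phi 1 * e / 2) ^+ 2); last first.
  by field; rewrite !gt_eqF.
rewrite ler_wpM2l ?divr_ge0 ?sqr_ge0// lerXn2r// nnegrE.
  by rewrite !mulr_ge0 ?phi_ge0// ltW.
exact: ltW.
Qed.

(** On the cube a derivative in x_i is a finite difference. Its mean value is traded for the
    symmetric average over the two endpoints, which averaging over a flip can redistribute; the
    price is cubic. *)
Lemma Vx_trapezoid k e a b : 0 < e -> e <= a <= 1 - e -> e <= b <= 1 - e ->
  0 <= k <= 1 ->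
  (Vx k a - Vx k b) * (a - b) <=
  (Vxx k a + Vxx k b) / 2 * (a - b) ^+ 2 + 8 / (phi (1:R) * e) ^+ 2 * `|a - b| ^+ 3.
Proof.
wlog ab : a b / b <= a.
  move=> H e0 ae be k01; case/orP: (le_total b a) => [/H|/H]; first exact.
  move=> /(_ e0 be ae k01); rewrite distrC addrC -sqrrN opprB; set X := _ / 2.
  by rewrite {}/X (addrC (Vxx k b)) -mulrNN !opprB; lra.
move=> e0 ae be k01; have k0 : 0 <= k by case/andP: k01.
have ab0 : 0 <= a - b by lra.
have bt z : b <= z <= a -> e <= z <= 1 - e.
  move: ae be => /andP[? ?] /andP[? ?] /andP[? ?]; apply/andP; split; lra.
have [|c [cab ->]] := @mvt _ (Vx k) (Vxx k) b a ab.
  by move=> z /bt /andP[? ?]; apply: der_Vx; apply/andP; split; lra.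
have ce := bt _ cab.
have h1 := Vxx_lip e0 ae ce k01; have h2 := Vxx_lip e0 be ce k01.
set M := 8 / _ in h1 h2 *.
have M0 : 0 <= M by rewrite divr_ge0 ?sqr_ge0.
have h3 : Vxx k c <= (Vxx k a + Vxx k b) / 2 + M * (a - b).
  move: h1 h2; rewrite !ler_norml => /andP[_ h1] /andP[_ h2].
  have c1 : `|c - a| <= a - b by case/andP: cab => ? ?; rewrite ler_norml; lra.
  have c2 : `|c - b| <= a - b by case/andP: cab => ? ?; rewrite ler_norml; lra.
  nra.
rewrite (ger0_norm ab0) -mulrA -expr2 [X in _ + _ * X]exprSr.
have := sqr_ge0 (a - b); nra.
Qed.

(* The expectation of the positive part of x + t G for a standard Gaussian G. *)
Definition smooth_pos t x : R := t * phi (x / t) + x * Phi (x / t).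

Lemma der_smooth_pos t x : t != 0 -> is_derive x 1 (smooth_pos t) (Phi (x / t)).
Proof. by move=> t0; apply: der_eq; rewrite /GRing.scale/=; field. Qed.

Lemma der_smooth_pos_scale t x : t != 0 -> is_derive t 1 (fun t => smooth_pos t x) (phi (x / t)).
Proof.
move=> t0; have di := @is_deriveV R id t _ 1 t0 (is_derive_id _ _).
by apply: der_eq; rewrite /GRing.scale/=; field.
Qed.

(** Smoothing a convex function increases it; both bounds are [mills], at x/t and at -x/t. *)
Lemma smooth_pos_ge t x : 0 < t -> 0 <= smooth_pos t x /\ x <= smooth_pos t x.
Proof.
move=> t0; rewrite /smooth_pos; set u := x / t.
have e : x = t * u by rewrite /u; field; rewrite gt_eqF.
split.
  rewrite {1}e -mulrA -mulrDr mulr_ge0 ?mills// ltW//.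
have := mills (- u); rewrite phiN PhiN => h.
rewrite -subr_ge0 (_ : _ - x = t * (phi u + - u * (1 - Phi u))).
  by rewrite mulr_ge0// ltW.
by rewrite e; ring.
Qed.

(** One Lindeberg replacement: a centred two-valued variable of variance v becomes a Gaussian one,
    which only enlarges the smoothing scale. The second order Taylor term matches the growth in t by
    the heat equation; the error is of third order. *)
Lemma smooth_pos_step t x g (p0 p1 w0 w1 v : R) : 0 < t -> 0 <= p0 -> 0 <= p1 ->
  p0 + p1 = 1 -> p0 * w0 + p1 * w1 = 0 -> p0 * w0 ^+ 2 + p1 * w1 ^+ 2 = v ->
  v <= 1 -> `|w0| <= 2 -> `|w1| <= 2 ->
  p0 * smooth_pos t (x + g * w0) + p1 * smooth_pos t (x + g * w1) <=
  smooth_pos (Num.sqrt (t ^+ 2 + g ^+ 2 * v)) x + 3 * v * `|g| ^+ 3 / t ^+ 2.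
Proof.
move=> t0 p00 p10 p01 m0 m2 v1 w02 w12.
have tn : t != 0 by rewrite gt_eqF.
have v0 : 0 <= v by rewrite -m2 addr_ge0// mulr_ge0 ?sqr_ge0.
have T z : smooth_pos t (x + z) <= smooth_pos t x + Phi (x / t) * z + phi (x / t) / t / 2 * z ^+ 2
    + (t ^+ 2)^-1 * `|z| ^+ 3.
  have h1 (y : R) : is_derive y 1 (fun x => Phi (x / t)) (phi (y / t) / t).
    by apply: der_eq; rewrite /GRing.scale/= mulr0 add0r mulr1.
  have h2 y : `|phi (y / t) / t - phi (x / t) / t| <= (t ^+ 2)^-1 * `|y - x|.
    rewrite -mulrBl normrM normfV (gtr0_norm t0).
    rewrite ler_pdivrMr// (le_trans (phi_lip _ _))// -mulrBl normrM normfV.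
    by rewrite (gtr0_norm t0) le_eqVlt; apply/orP; left; apply/eqP; field.
  have := taylor2 (x + z) (fun y => der_smooth_pos y tn) h1 h2.
  rewrite (_ : x + z - x = z); last by ring.
  by rewrite ler_norml => /andP[_]; lra.
pose t' := Num.sqrt (t ^+ 2 + g ^+ 2 * v); rewrite -/t'.
have gv0 : 0 <= g ^+ 2 * v by rewrite mulr_ge0 ?sqr_ge0.
have t't : t' ^+ 2 = t ^+ 2 + g ^+ 2 * v by rewrite sqr_sqrtr// addr_ge0 ?sqr_ge0.
have tt' : t <= t'.
  by rewrite -[leLHS](ger0_norm (ltW t0)) -sqrtr_sqr ler_wsqrtr// lerDl.
have t'0 : 0 < t' by exact: lt_le_trans tt'.
(* Convexity in the scale: the derivative phi(x/t) is nondecreasing in t > 0. *)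
have S : smooth_pos t x + phi (x / t) * (t' - t) <= smooth_pos t' x.
  have [|c [/andP[tc ct'] e]] := @mvt _ (fun t => smooth_pos t x) (fun t => phi (x / t)) t t' tt'.
    by move=> s /andP[ts _]; apply: der_smooth_pos_scale; rewrite gt_eqF// (lt_le_trans t0).
  have c0 : 0 < c by exact: lt_le_trans tc.
  have pc : phi (x / t) <= phi (x / c).
    rewrite !phiE ler_wpM2l ?normal_peak_ge0// ler_expR lerN2 ler_wpM2r//.
    rewrite !exprMn ler_wpM2l ?sqr_ge0//.
    have ic : c^-1 <= t^-1 by rewrite lef_pV2 ?posrE.
    by rewrite lerXn2r// nnegrE invr_ge0 ltW.
  have : phi (x / t) * (t' - t) <= phi (x / c) * (t' - t) by rewrite ler_wpM2r// subr_ge0.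
  by rewrite -e; lra.
have tt'g : (t' - t) ^+ 2 <= g ^+ 2 * v by nra.
have gn := normr_ge0 g.
have tt'1 : t' - t <= `|g|.
  rewrite -[leLHS]ger0_norm ?subr_ge0// -ler_sqr ?nnegrE// !real_normK ?num_real//.
  by apply: (le_trans tt'g); rewrite ler_piMr ?sqr_ge0.
(* As g^2 v = (t' - t)^2 + 2 t (t' - t), the discrepancy is phi(x/t) (t' - t)^2 / (2t). It is cubic
   because t' - t <= |g| and 2 t (t' - t) <= g^2 v. *)
have Q : phi (x / t) / t / 2 * (g ^+ 2 * v) <= phi (x / t) * (t' - t) + v * `|g| ^+ 3 / t ^+ 2.
  have gd : g ^+ 2 * v = (t' - t) ^+ 2 + 2 * t * (t' - t).
    by rewrite (_ : g ^+ 2 * v = t' ^+ 2 - t ^+ 2); [ring|rewrite t't; ring].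
  have d0 : 0 <= t' - t by rewrite subr_ge0.
  have d1 : 2 * t * (t' - t) <= g ^+ 2 * v by rewrite gd lerDr sqr_ge0.
  rewrite {1}gd (_ : _ * (_ + _) = phi (x / t) * (t' - t) +
    phi (x / t) * ((t' - t) * (2 * t * (t' - t))) / t ^+ 2 / 4); last by field.
  rewrite lerD2l ler_pdivrMr// ler_pdivrMr ?exprn_gt0//.
  rewrite [leRHS]mulrAC divfK ?expf_neq0//.
  have d2 : (t' - t) * (2 * t * (t' - t)) <= `|g| * (g ^+ 2 * v).
    by apply: ler_pM => //; rewrite !mulr_ge0// ltW.
  rewrite (_ : v * `|g| ^+ 3 * 4 = 4 * (`|g| * (g ^+ 2 * v))); last first.
    by rewrite -(real_normK (num_real g)); ring.
  have := phi_le1 (x / t); have := phi_ge0 (x / t).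
  have : 0 <= (t' - t) * (2 * t * (t' - t)) by rewrite !mulr_ge0// ltW.
  nra.
(* Averaging z^2 restores the variance, so the Taylor error contributes 2 v |g|^3 / t^2; with the
   error of the scale this makes 3. *)
have c3 z : `|z| <= 2 -> `|g * z| ^+ 3 <= 2 * `|g| ^+ 3 * z ^+ 2.
  move=> z2; rewrite normrM exprMn (exprSr `|z|) (real_normK (num_real z)).
  have : 0 <= `|g| ^+ 3 * z ^+ 2 by rewrite mulr_ge0 ?sqr_ge0 ?exprn_ge0.
  by have := normr_ge0 z; nra.
have T0 := T (g * w0); have T1 := T (g * w1).
have C0 := c3 _ w02; have C1 := c3 _ w12.
have ti : 0 < (t ^+ 2)^-1 by rewrite invr_gt0 exprn_gt0.
set b := phi (x / t) in T0 T1 S Q *; set P := Phi (x / t) in T0 T1 *.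
set h := smooth_pos t x in T0 T1 S *; set ti2 := (t ^+ 2)^-1 in T0 T1 Q ti *.
have {T0} T0 : p0 * smooth_pos t (x + g * w0) <= p0 * (h + P * (g * w0) + b / t / 2 * (g * w0) ^+ 2 + ti2 * (2 * `|g| ^+ 3 * w0 ^+ 2)).
  by rewrite ler_wpM2l// (le_trans T0)// lerD2l ler_wpM2l// ltW.
have {T1} T1 : p1 * smooth_pos t (x + g * w1) <= p1 * (h + P * (g * w1) + b / t / 2 * (g * w1) ^+ 2 + ti2 * (2 * `|g| ^+ 3 * w1 ^+ 2)).
  by rewrite ler_wpM2l// (le_trans T1)// lerD2l ler_wpM2l// ltW.
have E : p0 * (h + P * (g * w0) + b / t / 2 * (g * w0) ^+ 2 + ti2 * (2 * `|g| ^+ 3 * w0 ^+ 2)) +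
  p1 * (h + P * (g * w1) + b / t / 2 * (g * w1) ^+ 2 + ti2 * (2 * `|g| ^+ 3 * w1 ^+ 2)) =
  (p0 + p1) * h + P * g * (p0 * w0 + p1 * w1) + b / t / 2 * (g ^+ 2 * (p0 * w0 ^+ 2 + p1 * w1 ^+ 2))
  + 2 * (p0 * w0 ^+ 2 + p1 * w1 ^+ 2) * `|g| ^+ 3 * ti2 by ring.
rewrite p01 m0 m2 in E.
lra.
Qed.
End W.

(** * Noise and derivatives on the cube *)

Section cube.
Context {R : realType}.
Implicit Types (n : nat) (s t : R).

Lemma der_prod (I : eqType) (r : seq I) (u : I -> R -> R) (du : I -> R) s :
  uniq r -> (forall i, is_derive s 1 (u i) (du i)) ->
  is_derive s 1 (fun s => \prod_(i <- r) u i s)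
    (\sum_(i <- r) du i * \prod_(j <- r | j != i) u j s).
Proof.
move=> + ud; elim: r => [_|a r IH] /=.
  by rewrite big_nil; under eq_fun do rewrite big_nil; exact: der_cst.
move=> /andP[ar /IH d]; under eq_fun do rewrite big_cons.
apply: (der_eq (derM (ud a) d)); rewrite big_cons big_cons eqxx/=; congr (_ + _).
  congr (_ * _); rewrite big_seq_cond [RHS]big_seq_cond; apply: eq_bigl => j.
  rewrite andbT; case: (boolP (j \in r)) => //= jr.
  by apply/esym; apply: contraNneq ar => <-.
rewrite mulr_sumr; apply: eq_big_seq => i ir.
rewrite big_cons ifT; first by rewrite mulrCA.
by apply: contraNneq ar => ->.
Qed.

Section fixed_n.
Variable n : nat.
Implicit Types (x y z : cube n) (f g : cube n -> R) (i j : 'I_n).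

Lemma flipK i : involutive (@flip n i).
Proof. by move=> x; apply/ffunP => j; rewrite !ffunE; case: eqP => //; rewrite negbK. Qed.

Lemma spin_flip i x : spin R (flip i x) i = - spin R x i.
Proof. by rewrite /spin ffunE eqxx signrN. Qed.

Lemma spin_flip_neq i j x : j != i -> spin R (flip i x) j = spin R x j.
Proof. by move=> ji; rewrite /spin ffunE (negPf ji). Qed.

Lemma spin_sq i x : spin R x i * spin R x i = 1.
Proof. by rewrite -expr2 sqrr_sign. Qed.

Lemma sum_flip i f : \sum_x f (flip i x) = \sum_x f x.
Proof. by rewrite [RHS](reindex_inj (can_inj (flipK i))). Qed.

Definition rest s i x z : R := \prod_(j < n | j != i) ((1 + s * spin R x j * spin R z j) / 2).

Lemma noiseE s i x z :
  noise s x z = (1 + s * spin R x i * spin R z i) / 2 * rest s i x z.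
Proof. by rewrite /noise (bigD1 i). Qed.

Lemma rest_flipl s i x z : rest s i (flip i x) z = rest s i x z.
Proof. by apply: eq_bigr => j ji; rewrite spin_flip_neq. Qed.

Lemma rest_flipr s i x z : rest s i x (flip i z) = rest s i x z.
Proof. by apply: eq_bigr => j ji; rewrite spin_flip_neq. Qed.

Lemma noiseC s x z : noise s x z = noise s z x.
Proof. by apply: eq_bigr => i _; rewrite mulrAC. Qed.

(* Partial derivative at s x of the multilinear extension of f. *)
Definition pder s f i x : R := \sum_z spin R z i / 2 * rest s i x z * f z.

(** The multilinear extension is affine in each coordinate, so this finite difference is exact. *)
Lemma Tnoise_flip s f i x :
  Tnoise s f x - Tnoise s f (flip i x) = 2 * s * spin R x i * pder s f i x.
Proof.
rewrite /Tnoise /pder -sumrB mulr_sumr; apply: eq_bigr => z _.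
by rewrite !(noiseE s i) rest_flipl spin_flip; field.
Qed.

Lemma pder_flip s f i x : pder s f i (flip i x) = pder s f i x.
Proof. by apply: eq_bigr => z _; rewrite rest_flipl. Qed.

Lemma der_Tnoise f x s :
  is_derive s 1 (fun s => Tnoise s f x) (\sum_i spin R x i * pder s f i x).
Proof.
have d z : is_derive s 1 (fun s => noise s x z)
    (\sum_i spin R x i * spin R z i / 2 * rest s i x z).
  apply: der_prod => [|i]; first exact: index_enum_uniq.
  by apply: der_eq; rewrite /GRing.scale/=; lra.
have -> : \sum_i spin R x i * pder s f i x =
    \sum_z (\sum_i spin R x i * spin R z i / 2 * rest s i x z) * f z.
  under [RHS]eq_bigr do rewrite mulr_suml.
  rewrite exchange_big; apply: eq_bigr => i _; rewrite mulr_sumr.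
  by apply: eq_bigr => z _; ring.
rewrite /Tnoise; apply: der_sum => z.
by apply: (der_eq (derM (d z) (der_cst (f z) s))); rewrite mulr0 addr0.
Qed.

(** For signs a and b, (1 + s b a)(a - s b) = (1 - s^2) a. Thus [pder] is the coefficient of f along
    the centred i-th coordinate, whose variance under [noise s x] is 1 - s^2. *)
Lemma noise_score s f i x :
  \sum_z noise s x z * f z * (spin R z i - s * spin R x i) =
  (1 - s ^+ 2) * pder s f i x.
Proof.
rewrite mulr_sumr; apply: eq_bigr => z _; rewrite (noiseE s i).
have := spin_sq i x; have := spin_sq i z.
set a := spin R z i; set b := spin R x i => aa bb.
have -> : (1 - s ^+ 2) * (a / 2 * rest s i x z * f z) =
  (a + s * b * (a * a) - s * b - s ^+ 2 * (b * b) * a) / 2 * rest s i x z * f z.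
  by rewrite aa bb; field.
by field.
Qed.

Definition diff i f z : R := spin R z i * (f z - f (flip i z)) / 2.

(** Differentiation commutes with the noise; no factor s appears because the derivative is taken at
    the point s x. As [diff i f] does not depend on z i, the missing i-th factor of the kernel can
    be restored: its odd part sums to 0. *)
Lemma pderE s f i x : pder s f i x = Tnoise s (diff i f) x.
Proof.
have h1 : pder s f i x = (\sum_z rest s i x z * diff i f z) / 2.
  have : pder s f i x + pder s f i x = \sum_z rest s i x z * diff i f z.
    rewrite {2}/pder -(sum_flip i) /pder -big_split; apply: eq_bigr => z _ /=.
    by rewrite rest_flipr spin_flip /diff; field.
  by move=> <-; field.
have h2 : \sum_z rest s i x z * (spin R z i * diff i f z) = 0.
  have : \sum_z rest s i x z * (spin R z i * diff i f z) =
      - \sum_z rest s i x z * (spin R z i * diff i f z).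
    rewrite -[LHS](sum_flip i) -sumrN; apply: eq_bigr => z _.
    by rewrite rest_flipr spin_flip /diff spin_flip flipK; field.
  lra.
have -> : pder s f i x = (\sum_z rest s i x z * diff i f z) / 2 +
    s * spin R x i / 2 * \sum_z rest s i x z * (spin R z i * diff i f z).
  by rewrite h2 mulr0 addr0.
rewrite /Tnoise mulr_suml mulr_sumr -big_split; apply: eq_bigr => z _ /=.
by rewrite (noiseE s i); field.
Qed.

Lemma noise_comp s t x z :
  \sum_y noise s x y * noise t y z = noise (s * t) x z.
Proof.
under eq_bigr do rewrite (noiseC t).
have := noise_prodE s x (fun i b => (1 + t * spin R z i * (-1) ^+ (b : bool)) / 2).
move=> ->; apply: eq_bigr => i _; rewrite expr0 expr1; by field.
Qed.

Lemma Tnoise_comp s t f x : Tnoise s (Tnoise t f) x = Tnoise (s * t) f x.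
Proof.
rewrite /Tnoise; under eq_bigr do rewrite mulr_sumr.
rewrite exchange_big; apply: eq_bigr => z _ /=; rewrite -noise_comp mulr_suml.
by apply: eq_bigr => y _; rewrite mulrA.
Qed.

Lemma expectE f : expect f = (\sum_x f x) / 2 ^+ n. Proof. by []. Qed.

Lemma expect_Tnoise s f g :
  expect (fun x => f x * Tnoise s g x) = expect (fun x => Tnoise s f x * g x).
Proof.
rewrite !expectE; congr (_ / _); rewrite /Tnoise.
under eq_bigr do rewrite mulr_sumr; rewrite exchange_big.
apply: eq_bigr => y _ /=; rewrite mulr_suml; apply: eq_bigr => x _.
by rewrite noiseC; ring.
Qed.

Lemma le_expect f g : (forall x, f x <= g x) -> expect f <= expect g.
Proof. by move=> fg; rewrite ler_wpM2r ?invr_ge0 ?exprn_ge0// ler_sum. Qed.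

Lemma expectD f g : expect (fun x => f x + g x) = expect f + expect g.
Proof. by rewrite /expect big_split mulrDl. Qed.

Lemma expectZ (a : R) f : expect (fun x => a * f x) = a * expect f.
Proof. by rewrite /expect -mulr_sumr mulrA. Qed.

Lemma expect_sum (I : finType) (F : I -> cube n -> R) :
  expect (fun x => \sum_i F i x) = \sum_i expect (F i).
Proof. by rewrite /expect exchange_big mulr_suml. Qed.

Lemma expect_cst (a : R) : expect (fun _ : cube n => a) = a.
Proof.
rewrite /expect sumr_const (_ : #|_| = (2 ^ n)%N); last first.
  by rewrite card_ffun card_bool card_ord.
by rewrite -[X in X / _]mulr_natr natrX mulfK// expf_neq0.
Qed.

Lemma expect_flip i f : expect (fun x => f (flip i x)) = expect f.
Proof. by rewrite /expect sum_flip. Qed.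

Lemma expect_ge0 f : (forall x, 0 <= f x) -> 0 <= expect f.
Proof. by move=> f0; rewrite -(expect_cst 0) le_expect. Qed.

Lemma Tnoise0 f x : Tnoise 0 f x = expect f.
Proof.
rewrite /expect /Tnoise mulr_suml; apply: eq_bigr => z _; rewrite mulrC.
congr (_ * _); rewrite /noise; under eq_bigr do rewrite !mul0r addr0.
by rewrite prodr_const card_ord mul1r exprVn.
Qed.

Lemma TnoiseD s f g x : Tnoise s (fun x => f x + g x) x = Tnoise s f x + Tnoise s g x.
Proof. by rewrite /Tnoise -big_split; apply: eq_bigr => z _; rewrite mulrDr. Qed.

Lemma TnoiseZ s (a : R) f x : Tnoise s (fun x => a * f x) x = a * Tnoise s f x.
Proof. by rewrite /Tnoise mulr_sumr; apply: eq_bigr => z _; rewrite mulrCA. Qed.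

Lemma Tnoise_cst s (a : R) x : Tnoise s (fun=> a) x = a.
Proof. by rewrite /Tnoise -mulr_suml noise_sum1 mul1r. Qed.

Lemma le_Tnoise s f g x : 0 <= s <= 1 -> (forall x, f x <= g x) ->
  Tnoise s f x <= Tnoise s g x.
Proof. by move=> s01 fg; apply: ler_sum => z _; rewrite ler_wpM2l ?noise_ge0. Qed.

End fixed_n.
End cube.

(** * Level-1 inequality *)

Section cons.
Context {R : realType}.

Definition cons_cube n (b : bool) (z : cube n) : cube n.+1 :=
  [ffun i => if unlift ord0 i is Some j then z j else b].

Lemma spin_cons0 n b (z : cube n) : spin R (cons_cube b z) ord0 = (-1) ^+ b.
Proof. by rewrite /spin ffunE unlift_none. Qed.

Lemma spin_consS n b (z : cube n) i :
  spin R (cons_cube b z) (lift ord0 i) = spin R z i.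
Proof. by rewrite /spin ffunE liftK. Qed.

Lemma sum_cons n (F : cube n.+1 -> R) :
  \sum_z F z = \sum_(z : cube n) (F (cons_cube false z) + F (cons_cube true z)).
Proof.
pose h (u : bool * cube n) := cons_cube u.1 u.2.
rewrite (reindex h); last first.
  exists (fun z : cube n.+1 => (z ord0, [ffun j : 'I_n => z (lift ord0 j)])) => [[b z] _|z _].
    rewrite /h /cons_cube ffunE unlift_none; congr (_, _).
    by apply/ffunP => j; rewrite !ffunE liftK.
  by apply/ffunP => i; rewrite !ffunE; case: unliftP => [j ->|->]//=; rewrite ffunE.
transitivity (\sum_(b : bool) \sum_(z : cube n) F (cons_cube b z)).
  by rewrite pair_big.
by rewrite big_bool /= addrC -big_split.
Qed.

(** The law of independent signs with means p i. [noise s x] is the case p i = s x_i. *)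
Definition wt n (p : 'I_n -> R) (z : cube n) : R :=
  \prod_i ((1 + p i * spin R z i) / 2).

Lemma wt_cons n (p : 'I_n.+1 -> R) b z :
  wt p (cons_cube b z) = (1 + p ord0 * (-1) ^+ b) / 2 * wt (p \o lift ord0) z.
Proof.
rewrite /wt big_ord_recl spin_cons0; congr (_ * _).
by apply: eq_bigr => i _; rewrite spin_consS.
Qed.

Lemma wt_sum1 n (p : 'I_n -> R) : \sum_z wt p z = 1.
Proof.
elim: n p => [|n IH] p.
  rewrite (eq_bigr (fun=> 1)) => [|z _]; last by rewrite /wt big_ord0.
  by rewrite sumr_const card_ffun card_ord expn0.
rewrite sum_cons -[RHS](IH (p \o lift ord0)).
by apply: eq_bigr => z _; rewrite !wt_cons expr0 expr1; field.
Qed.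

Lemma wt_ge0 n (p : 'I_n -> R) z : (forall i, -1 <= p i <= 1) -> 0 <= wt p z.
Proof.
move=> p1; apply: prodr_ge0 => i _; rewrite divr_ge0//.
have /andP[? ?] := p1 i; rewrite /spin; case: (z i); rewrite ?expr1 ?expr0; lra.
Qed.

(** Induction on the coordinates: [smooth_pos_step] absorbs coordinate 0 into the scale, and the
    others are treated at the larger scale t', where the error bound is only smaller. *)
Lemma lindeberg n (p g : 'I_n -> R) (t c : R) : 0 < t ->
  (forall i, -1 <= p i <= 1) ->
  \sum_z wt p z * smooth_pos t (c + \sum_i g i * (spin R z i - p i)) <=
  smooth_pos (Num.sqrt (t ^+ 2 + \sum_i g i ^+ 2 * (1 - p i ^+ 2))) c +
  3 * (\sum_i (1 - p i ^+ 2) * `|g i| ^+ 3) / t ^+ 2.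
Proof.
elim: n p g t c => [|n IH] p g t c t0 p1.
  rewrite !big_ord0 mulr0 mul0r !addr0 sqrtr_sqr gtr0_norm//.
  rewrite (eq_bigr (fun z => wt p z * smooth_pos t c)) => [|z _]; last by rewrite big_ord0 addr0.
  by rewrite -mulr_suml wt_sum1 mul1r.
pose p' := p \o lift ord0; pose g' := g \o lift ord0.
pose v := 1 - p ord0 ^+ 2; pose t' := Num.sqrt (t ^+ 2 + g ord0 ^+ 2 * v).
have p1' i : -1 <= p' i <= 1 by exact: p1.
have /andP[pl pr] := p1 ord0.
have v0 : 0 <= v by rewrite /v; nra.
have gv0 : 0 <= g ord0 ^+ 2 * v by rewrite mulr_ge0 ?sqr_ge0.
have t't : t' ^+ 2 = t ^+ 2 + g ord0 ^+ 2 * v by rewrite sqr_sqrtr// addr_ge0 ?sqr_ge0.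
have t'0 : 0 < t' by rewrite sqrtr_gt0 ltr_wpDr// exprn_gt0.
pose S (z : cube n) := c + \sum_i g' i * (spin R z i - p' i).
have e b z : c + \sum_i g i * (spin R (cons_cube b z) i - p i) =
    S z + g ord0 * ((-1) ^+ b - p ord0).
  rewrite big_ord_recl spin_cons0 /S -addrA; congr (c + _); rewrite addrC; congr (_ + _).
  by apply: eq_bigr => i _; rewrite spin_consS.
pose er := 3 * v * `|g ord0| ^+ 3 / t ^+ 2.
have h z : wt p (cons_cube false z) * smooth_pos t (c + \sum_i g i * (spin R (cons_cube false z) i - p i)) +
    wt p (cons_cube true z) * smooth_pos t (c + \sum_i g i * (spin R (cons_cube true z) i - p i)) <=
    wt p' z * smooth_pos t' (S z) + wt p' z * er.
  rewrite !wt_cons !e expr0 expr1 -mulrDr mulrAC [X in _ + X]mulrAC -mulrDl mulrC.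
  rewrite ler_wpM2l ?wt_ge0//; apply: smooth_pos_step => //; rewrite /v; try lra; try by field.
    by nra.
  by rewrite ler_norml; lra.
  by rewrite ler_norml; lra.
rewrite sum_cons (le_trans (ler_sum _ (fun z _ => h z)))//.
rewrite big_split/= -mulr_suml wt_sum1 mul1r.
have := IH p' g' t' c t'0 p1'; rewrite t't -/(S _) => IH'.
rewrite !big_ord_recl -/v.
have er' : 3 * (\sum_i (1 - p' i ^+ 2) * `|g' i| ^+ 3) / t' ^+ 2 <=
    3 * (\sum_i (1 - p' i ^+ 2) * `|g' i| ^+ 3) / t ^+ 2.
  rewrite ler_wpM2l//; last by rewrite lef_pV2 ?posrE ?exprn_gt0// t't lerDl.
  rewrite mulr_ge0// sumr_ge0// => i _; rewrite mulr_ge0 ?exprn_ge0//.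
  by have := p1' i; nra.
rewrite t't in er'; set B := \sum_i _ in er' IH'.
have eB : \sum_(i < n) (1 - p (lift ord0 i) ^+ 2) * `|g (lift ord0 i)| ^+ 3 = B by [].
rewrite eB (_ : 3 * (_ + B) / _ = 3 * B / t ^+ 2 + er); last by rewrite /er; ring.
rewrite [leRHS]addrA lerD2r (addrA (t ^+ 2)); apply: (le_trans IH').
by apply: lerD; [exact: lexx|exact: er'].
Qed.

End cons.

Section level1.
Context {R : realType}.
Variables (n : nat) (s : R) (x : cube n) (f : cube n -> R).
Hypothesis s01 : 0 <= s <= 1.
Let g i := pder s f i x.
(** The orthogonal projection of f, under [noise s x], onto the span of the centred coordinates;
    hence E[f S] = E[S^2]. *)
Let S z := \sum_i g i * (spin R z i - s * spin R x i).

Lemma sum_fS : \sum_z noise s x z * (f z * S z) = (1 - s ^+ 2) * \sum_i g i ^+ 2.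
Proof.
rewrite mulr_sumr; under eq_bigr do rewrite !mulr_sumr.
rewrite exchange_big; apply: eq_bigr => i _.
rewrite expr2 mulrA -noise_score mulr_suml; apply: eq_bigr => z _; ring.
Qed.

(** [noise_score] is applied to S itself, whose i-th discrete derivative is the constant [g i]. *)
Lemma sum_SS : \sum_z noise s x z * S z ^+ 2 = (1 - s ^+ 2) * \sum_i g i ^+ 2.
Proof.
transitivity (\sum_i g i * \sum_z noise s x z * S z * (spin R z i - s * spin R x i)).
  under [RHS]eq_bigr do rewrite mulr_sumr.
  rewrite exchange_big; apply: eq_bigr => z _.
  rewrite expr2 mulrA {2}/S mulr_sumr; apply: eq_bigr => i _; ring.
rewrite mulr_sumr; apply: eq_bigr => i _.
rewrite noise_score pderE mulrCA expr2; congr (_ * (_ * _)).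
rewrite -[RHS](Tnoise_cst s (g i) x); congr (Tnoise s _ x); apply/funext => z.
rewrite /diff /S -sumrB (bigD1 i)//= big1 => [|j ji]; last first.
  by rewrite spin_flip_neq// subrr.
rewrite spin_flip addr0.
have -> : spin R z i * (g i * (spin R z i - s * spin R x i) -
  g i * (- spin R z i - s * spin R x i)) / 2 = g i * (spin R z i * spin R z i) by field.
by rewrite spin_sq mulr1.
Qed.

Lemma bessel : (forall z, 0 <= f z <= 1) ->
  (1 - s ^+ 2) * \sum_i g i ^+ 2 <= 1.
Proof.
move=> f01.
have h : 0 <= \sum_z noise s x z * (f z - S z) ^+ 2.
  by apply: sumr_ge0 => z _; rewrite mulr_ge0 ?noise_ge0 ?sqr_ge0.
have e : \sum_z noise s x z * (f z - S z) ^+ 2 = \sum_z noise s x z * f z ^+ 2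
    - 2 * (\sum_z noise s x z * (f z * S z)) + \sum_z noise s x z * S z ^+ 2.
  rewrite mulr_sumr -sumrB -big_split; apply: eq_bigr => z _ /=; ring.
have : \sum_z noise s x z * f z ^+ 2 <= 1.
  rewrite -[leRHS](noise_sum1 s x); apply: ler_sum => z _.
  by rewrite ler_piMr ?noise_ge0//; have := f01 z; nra.
by move: h; rewrite e sum_fS sum_SS; lra.
Qed.

(* Pointwise f S <= f c + (S - c)^+; the positive part is smoothed at scale t and
   Lindeberg replaces S by a Gaussian variable of the same variance. *)
Lemma level1 (t : R) : 0 < t -> (forall z, 0 <= f z <= 1) ->
  0 < Tnoise s f x < 1 ->
  (1 - s ^+ 2) * \sum_i g i ^+ 2 <= phi (Phi_inv (Tnoise s f x)) ^+ 2 + t ^+ 2 +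
  6 * (1 - s ^+ 2) * (\sum_i `|g i| ^+ 3) / t ^+ 2.
Proof.
move=> t0 f01 m01; set m := Tnoise s f x in m01 *; set y := Phi_inv m.
set v := (1 - s ^+ 2) * _.
have s2 : s ^+ 2 <= 1 by case/andP: s01 => ? ?; nra.
have v0 : 0 <= v.
  by rewrite mulr_ge0 ?subr_ge0// sumr_ge0// => i _; rewrite sqr_ge0.
pose tau := Num.sqrt (t ^+ 2 + v).
have tau2 : tau ^+ 2 = t ^+ 2 + v by rewrite sqr_sqrtr// addr_ge0 ?sqr_ge0.
have tau0 : 0 < tau by rewrite sqrtr_gt0 ltr_wpDr// exprn_gt0.
pose p i := s * spin R x i.
have psq i : p i ^+ 2 = s ^+ 2 by rewrite /p exprMn sqrr_sign mulr1.
have p1 i : -1 <= p i <= 1.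
  by rewrite -ler_norml /p normrM normr_sign mulr1 ger0_norm; case/andP: s01.
have L := lindeberg g (tau * y) t0 p1.
have e1 : \sum_i g i ^+ 2 * (1 - p i ^+ 2) = v.
  by rewrite /v mulr_sumr; apply: eq_bigr => i _; rewrite psq mulrC.
have e2 : \sum_i (1 - p i ^+ 2) * `|g i| ^+ 3 = (1 - s ^+ 2) * \sum_i `|g i| ^+ 3.
  by rewrite mulr_sumr; apply: eq_bigr => i _; rewrite psq.
rewrite e1 e2 -/tau in L.
(* The threshold c = - tau y is the one that a Gaussian of variance tau^2 exceeds with probability
   m, which is what makes the constant sharp. *)
have u1 : v <= - (tau * y) * m + \sum_z wt p z * smooth_pos t (tau * y + S z).
  rewrite /v -sum_fS /m /Tnoise mulr_sumr -big_split; apply: ler_sum => z _ /=.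
  rewrite (_ : noise s x z = wt p z)//; set W := wt p z; set H := smooth_pos _ _.
  rewrite (_ : - _ * (W * f z) + W * H = W * (- (tau * y) * f z + H)); last by ring.
  rewrite ler_wpM2l ?wt_ge0// /H.
  have [h0 h1] := smooth_pos_ge (tau * y + S z) t0; have := f01 z; nra.
have u2 : - (tau * y) * m + smooth_pos tau (tau * y) = tau * phi y.
  have -> : m = Phi y by rewrite /y Phi_invK.
  rewrite /smooth_pos (_ : tau * y / tau = y); first by ring.
  by field; rewrite gt_eqF.
(* From 2 tau phi(y) <= tau^2 + phi(y)^2 and tau^2 = t^2 + v, twice the next bound solves for v and
   doubles the error 3 to 6. *)
have : 0 <= (tau - phi y) ^+ 2 by rewrite sqr_ge0.
have : v <= tau * phi y + 3 * ((1 - s ^+ 2) * (\sum_i `|g i| ^+ 3)) / t ^+ 2.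
  rewrite -u2 (le_trans u1)//; set H := smooth_pos _ _ in L *.
  by move: L; set Z := \sum_z _; lra.
set A := _ / t ^+ 2; rewrite (_ : 6 * _ * _ / _ = 2 * A); last by rewrite /A; ring.
by rewrite sqrrB tau2; lra.
Qed.

End level1.

(** * Two-point inequality *)

Section twopoint.
Context {R : realType}.
Implicit Types (p x y a b c u : R).

Lemma der_powR (a x : R) (f : R -> R) df : 0 < f x -> is_derive x 1 f df ->
  is_derive x 1 (fun x => f x `^ a) (a * f x `^ (a - 1) * df).
Proof.
move=> fx0 fd; have h := is_derive1_powR a fx0.
exact: (@der_comp _ (fun y => y `^ a) f).
Qed.

Lemma bernoulli a u : 1 <= a -> 0 <= u -> 1 + a * u <= (1 + u) `^ a.
Proof.
move=> a1 u0.
have d (v : R) : 0 <= v <= u ->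
    is_derive v 1 (fun v => (1 + v) `^ a - a * v) (a * (1 + v) `^ (a - 1) - a).
  move=> /andP[v0 _]; have h : is_derive v 1 (fun v : R => 1 + v) 1.
    by apply: (der_eq (derD (der_cst 1 v) (der_id v))); rewrite add0r.
  apply: (der_eq (derB (der_powR a _ h) (derZ a (der_id v)))); first by lra.
  by rewrite !mulr1.
have := der_homo u0 d; rewrite addr0 powR1 mulr0 subr0 => H.
suff : 1 <= (1 + u) `^ a - a * u by lra.
apply: H => v /andP[v0 _]; have : 1 <= (1 + v) `^ (a - 1).
  by rewrite -[leLHS](powRr0 (1 + v)) ler_powR; lra.
by nra.
Qed.

(** Arithmetic-geometric mean: the product of the two terms is (1 - y^2)^(-r) >= 1. *)
Lemma powR_sum_ge2 r y : 0 <= r -> 0 <= y < 1 ->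
  2 <= (1 + y) `^ (- r) + (1 - y) `^ (- r).
Proof.
move=> r0 /andP[y0 y1]; set A := _ `^ _; set B := _ `^ _.
have A0 : 0 <= A := powR_ge0 _ _; have B0 : 0 <= B := powR_ge0 _ _.
have : 1 <= A * B.
  rewrite -powRM; [|lra..].
  have q0 : 0 < (1 + y) * (1 - y) by nra.
  rewrite powRN invf_ge1 ?powR_gt0// -[leRHS](powRr0 ((1 + y) * (1 - y))).
  by rewrite ger_powR// q0/=; nra.
move=> AB; have := sqr_ge0 (A - B); move=> AB2; rewrite leNgt; apply/negP => h.
have : (A + B) * (A + B) < 2 * 2 by apply: ltr_pM => //; rewrite addr_ge0.
by move: AB2; rewrite sqrrB; lra.
Qed.

(** The gap and its derivative vanish at 0, and by [powR_sum_ge2] its second derivative is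
    nonnegative. *)
Lemma two_point_even p y : 1 <= p <= 2 -> 0 <= y < 1 ->
  1 + p * (p - 1) / 2 * y ^+ 2 <= ((1 + y) `^ p + (1 - y) `^ p) / 2.
Proof.
move=> /andP[p1 p2] /andP[y0 y1].
have dp (a v : R) : 0 <= v <= y -> is_derive v 1 (fun v => (1 + v) `^ a) (a * (1 + v) `^ (a - 1)).
  move=> /andP[v0 vy]; have h : is_derive v 1 (fun v : R => 1 + v) 1.
    by apply: (der_eq (derD (der_cst 1 v) (der_id v))); rewrite add0r.
  by apply: (der_eq (der_powR a _ h)); [lra|rewrite mulr1].
have dm (a v : R) : 0 <= v <= y -> is_derive v 1 (fun v => (1 - v) `^ a) (- (a * (1 - v) `^ (a - 1))).
  move=> /andP[v0 vy]; have h : is_derive v 1 (fun v : R => 1 - v) (- 1).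
    by apply: (der_eq (derB (der_cst 1 v) (der_id v))); rewrite sub0r.
  by apply: (der_eq (der_powR a _ h)); [lra|rewrite mulrN1].
have d2 (v : R) : 0 <= v <= y -> is_derive v 1
    (fun v => (1 + v) `^ (p - 1) - (1 - v) `^ (p - 1) - 2 * (p - 1) * v)
    ((p - 1) * ((1 + v) `^ (- (2 - p)) + (1 - v) `^ (- (2 - p)) - 2)).
  move=> vy; apply: (der_eq (derB (derB (dp (p - 1) v vy) (dm (p - 1) v vy)) (derZ (2 * (p - 1)) (der_id v)))).
  by rewrite (_ : p - 1 - 1 = - (2 - p)); lra.
have F1 v : 0 <= v <= y -> 0 <= (1 + v) `^ (p - 1) - (1 - v) `^ (p - 1) - 2 * (p - 1) * v.
  move=> /andP[v0 vy]; have dz (z : R) (hz : 0 <= z <= v) := d2 z (introT andP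
    (conj (proj1 (andP hz)) (le_trans (proj2 (andP hz)) vy))).
  have := der_homo v0 dz; rewrite addr0 subr0 subrr mulr0 subr0; apply.
  move=> z /andP[z0 zv]; rewrite mulr_ge0 ?subr_ge0// powR_sum_ge2; lra.
have d1 (v : R) : 0 <= v <= y -> is_derive v 1
    (fun v => (1 + v) `^ p + (1 - v) `^ p - p * (p - 1) * v ^+ 2)
    (p * ((1 + v) `^ (p - 1) - (1 - v) `^ (p - 1) - 2 * (p - 1) * v)).
  move=> vy; have hv : is_derive v 1 (fun v : R => v ^+ 2) (2 * v).
    by apply: der_eq; rewrite /GRing.scale/=; lra.
  by apply: (der_eq (derB (derD (dp p v vy) (dm p v vy)) (derZ (p * (p - 1)) hv))); lra.
have := der_homo y0 d1; rewrite addr0 subr0 powR1 expr0n/= mulr0 subr0 => H.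
suff : 1 + 1 <= (1 + y) `^ p + (1 - y) `^ p - p * (p - 1) * y ^+ 2 by lra.
apply: H => v vy; rewrite mulr_ge0 ?F1//; lra.
Qed.

Lemma two_point_even1 p y : 1 <= p <= 2 -> 0 <= y <= 1 ->
  1 + p * (p - 1) / 2 * y ^+ 2 <= ((1 + y) `^ p + (1 - y) `^ p) / 2.
Proof.
move=> p12 /andP[y0]; rewrite le_eqVlt => /predU1P[->|y1]; last first.
  by apply: two_point_even => //; rewrite y0.
have /andP[p1 p2] := p12.
rewrite subrr powR0 ?gt_eqF ?(lt_le_trans ltr01)// addr0 expr1n mulr1.
apply/ler_addgt0Pr => e e0.
(* The endpoint y = 1 is approached by 1 - d. This changes the left side by at most 2d and the right
   side by at most d/2, so 5d <= e is enough. *)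
pose d := Num.min (1 / 2) (e / 5).
have d0 : 0 < d by rewrite /d lt_min; apply/andP; split; lra.
have d1 : d <= 1 / 2 by rewrite /d ge_min lexx.
have d2 : d <= e / 5 by rewrite /d ge_min lexx orbT.
have := @two_point_even p (1 - d) p12; rewrite (_ : 0 <= 1 - d < 1); last first.
  by apply/andP; split; lra.
move=> /(_ isT).
have -> : 1 - (1 - d) = d by ring.
have : d `^ p <= d by apply: ge1r_powR => //; apply/andP; split; lra.
have : (1 + (1 - d)) `^ p <= (1 + 1) `^ p.
  by apply: ge0_ler_powR; rewrite ?nnegrE; lra.
have : p * (p - 1) <= 2 by nra.
have : 0 <= p * (p - 1) by nra.
nra.
Qed.

(** Bonami's inequality on one bit. Dividing by the mean reduces to the values 1 + y and 1 - y; the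
    even case is raised to the power 2/p >= 1 and [bernoulli] turns p(p - 1)/2 into p - 1. *)
Lemma two_point a b p : 0 <= a -> 0 <= b -> 1 <= p <= 2 ->
  ((a + b) / 2) ^+ 2 + (p - 1) * ((a - b) / 2) ^+ 2 <=
  ((a `^ p + b `^ p) / 2) `^ (2 / p).
Proof.
wlog ba : a b / b <= a.
  move=> H a0 b0 p12; case/orP: (le_total b a) => [|ab]; first by move/H; exact.
  by rewrite (addrC a b) (addrC (a `^ p)) -(sqrrN ((a - b) / 2)) -mulNr opprB; exact: H.
move=> a0 b0 /andP[p1 p2].
set A := (a + b) / 2; set B := (a - b) / 2.
have p0 : 0 < p by lra.
have [A0|A0] := leP A 0.
  have -> : A = 0 by rewrite /A in A0 *; lra.
  have -> : B = 0 by rewrite /A in A0; rewrite /B; lra.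
  by rewrite expr0n/= mulr0 addr0 powR_ge0.
pose y := B / A.
have y01 : 0 <= y <= 1.
  rewrite /y divr_ge0 ?ler_pdivrMr ?mul1r//=; last exact: ltW.
    by rewrite /A /B; lra.
  by rewrite /B; lra.
have Be : B = A * y by rewrite /y mulrCA divff ?mulr1// gt_eqF.
have ae : a = A * (1 + y) by rewrite mulrDr mulr1 -Be /A /B; lra.
have be : b = A * (1 - y) by rewrite mulrBr mulr1 -Be /A /B; lra.
have /andP[y0 y1] := y01.
rewrite Be {1}ae {1}be (@powRM _ A (1 + y)); [|lra..].
rewrite (@powRM _ A (1 - y)); [|lra..].
rewrite -mulrDr -mulrA powRM ?powR_ge0//; last first.
  by rewrite mulr_ge0// addr_ge0 ?powR_ge0.
rewrite -powRrM (_ : p * (2 / p) = 2%:R); last by rewrite mulrCA divff ?mulr1// gt_eqF.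
rewrite powR_mulrn ?(ltW A0)//.
rewrite (_ : _ + _ = A ^+ 2 * (1 + (p - 1) * y ^+ 2)); last by ring.
rewrite ler_wpM2l ?sqr_ge0//.
have := two_point_even1 (introT andP (conj p1 p2)) y01.
set M := _ / 2 => M1; set u := p * (p - 1) / 2 * y ^+ 2 in M1.
have u0 : 0 <= u.
  by rewrite /u mulr_ge0 ?sqr_ge0// divr_ge0// mulr_ge0 ?subr_ge0// ltW.
apply: (@le_trans _ _ ((1 + u) `^ (2 / p))).
  have := @bernoulli (2 / p) u; rewrite (_ : 2 / p * u = (p - 1) * y ^+ 2); last first.
    by rewrite /u; field; rewrite gt_eqF.
  by apply => //; rewrite ler_pdivlMr// mul1r.
apply: ge0_ler_powR; rewrite ?nnegrE ?divr_ge0//; lra.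
Qed.

End twopoint.

(** * Hypercontractivity *)

Section hyper.
Context {R : realType}.
Implicit Types (s p : R).

Lemma cauchy2 (a b c d : R) : 0 <= a -> 0 <= b -> 0 <= c -> 0 <= d ->
  (a * c + b * d) / 2 <=
  Num.sqrt ((a ^+ 2 + b ^+ 2) / 2) * Num.sqrt ((c ^+ 2 + d ^+ 2) / 2).
Proof.
move=> a0 b0 c0 d0; have ab0 : 0 <= (a ^+ 2 + b ^+ 2) / 2 by rewrite divr_ge0 ?addr_ge0 ?sqr_ge0.
rewrite -sqrtrM// -[leLHS]ger0_norm ?divr_ge0 ?addr_ge0 ?mulr_ge0//.
by rewrite -sqrtr_sqr ler_wsqrtr//; have := sqr_ge0 (a * d - b * c); lra.
Qed.

(** The one-bit case of [hyper]: Cauchy-Schwarz followed by [two_point] with p - 1 = s^2. *)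
Lemma two_point_bilinear s (F0 F1 G0 G1 : R) : 0 <= s <= 1 ->
  0 <= F0 -> 0 <= F1 -> 0 <= G0 -> 0 <= G1 ->
  (F0 * ((1 + s) / 2 * G0 + (1 - s) / 2 * G1) +
   F1 * ((1 - s) / 2 * G0 + (1 + s) / 2 * G1)) / 2 <=
  Num.sqrt ((F0 ^+ 2 + F1 ^+ 2) / 2) *
  ((G0 `^ (1 + s ^+ 2) + G1 `^ (1 + s ^+ 2)) / 2) `^ (1 + s ^+ 2)^-1.
Proof.
move=> /andP[s0 s1] F00 F10 G00 G10.
set a := _ + _ * G1; set b := _ + _ * G1.
have a0 : 0 <= a by rewrite /a; nra.
have b0 : 0 <= b by rewrite /b; nra.
apply: (le_trans (cauchy2 F00 F10 a0 b0)); rewrite ler_wpM2l ?sqrtr_ge0//.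
set p := 1 + s ^+ 2; have p12 : 1 <= p <= 2 by rewrite /p; apply/andP; split; nra.
have := two_point G00 G10 p12.
have -> : ((G0 + G1) / 2) ^+ 2 + (p - 1) * ((G0 - G1) / 2) ^+ 2 = (a ^+ 2 + b ^+ 2) / 2.
  by rewrite /p /a /b; field.
rewrite (mulrC 2) powRrM => h.
rewrite -[leRHS]ger0_norm ?powR_ge0// -sqrtr_sqr ler_wsqrtr//.
by move: h; rewrite powR_mulrn ?powR_ge0.
Qed.

Lemma expect_cons n (f : cube n.+1 -> R) :
  expect f = (expect (fun x => f (cons_cube false x)) +
              expect (fun x => f (cons_cube true x))) / 2.
Proof. by rewrite /expect sum_cons big_split/= exprS -mulrDl invfM mulrA mulrAC. Qed.

Lemma noise_cons n s a b (x y : cube n) :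
  noise s (cons_cube a x) (cons_cube b y) =
  (1 + s * (-1) ^+ a * (-1) ^+ b) / 2 * noise s x y.
Proof.
rewrite /noise big_ord_recl !spin_cons0; congr (_ * _).
by apply: eq_bigr => i _; rewrite !spin_consS.
Qed.

Lemma Tnoise_cons n s b (x : cube n) (g : cube n.+1 -> R) :
  Tnoise s g (cons_cube b x) =
  (1 + s * (-1) ^+ b) / 2 * Tnoise s (fun y => g (cons_cube false y)) x +
  (1 - s * (-1) ^+ b) / 2 * Tnoise s (fun y => g (cons_cube true y)) x.
Proof.
rewrite /Tnoise sum_cons !mulr_sumr -big_split; apply: eq_bigr => y _ /=.
by rewrite !noise_cons expr0 expr1; ring.
Qed.

Lemma cube0E (F : cube 0 -> R) : expect F = F [ffun _ => false].
Proof.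
rewrite /expect expr0 divr1 (bigD1 [ffun _ => false])//= big1 ?addr0// => x.
by case/eqP; apply/ffunP => -[].
Qed.

(** The bilinear form tensorises directly. Splitting off coordinate 0 leaves four blocks; induction
    bounds each by a product of the norms [F b] and [G b'], and the one-bit inequality is applied to
    these norms. *)
Lemma hyper n s (f g : cube n -> R) : 0 <= s <= 1 ->
  expect (fun x => f x * Tnoise s g x) <=
  Num.sqrt (expect (fun x => f x ^+ 2)) *
  expect (fun x => `|g x| `^ (1 + s ^+ 2)) `^ (1 + s ^+ 2)^-1.
Proof.
move=> s01; have /andP[s0 s1] := s01.
have p0 : 0 < 1 + s ^+ 2 by rewrite ltr_wpDr ?sqr_ge0.
elim: n f g => [|n IH] f g.
  rewrite !cube0E sqrtr_sqr -powRrM divff ?gt_eqF// powRr1//.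
  rewrite (le_trans (ler_norm _))// normrM ler_wpM2l//.
  rewrite (_ : Tnoise s g _ = g [ffun=> false])//.
  rewrite /Tnoise (bigD1 [ffun _ => false])//= big1 ?addr0 => [|x].
    by rewrite /noise big_ord0 mul1r.
  by case/eqP; apply/ffunP => -[].
pose F b := Num.sqrt (expect (fun x => f (cons_cube b x) ^+ 2)).
pose G b := expect (fun x => `|g (cons_cube b x)| `^ (1 + s ^+ 2)) `^ (1 + s ^+ 2)^-1.
have F2 b : F b ^+ 2 = expect (fun x => f (cons_cube b x) ^+ 2).
  by rewrite sqr_sqrtr// expect_ge0// => x; rewrite sqr_ge0.
have Gp b : G b `^ (1 + s ^+ 2) = expect (fun x => `|g (cons_cube b x)| `^ (1 + s ^+ 2)).
  rewrite -powRrM mulVf ?gt_eqF// powRr1// expect_ge0// => x; exact: powR_ge0.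
rewrite [X in Num.sqrt X]expect_cons [X in X `^ (_^-1)]expect_cons -!F2 -!Gp.
apply: le_trans (two_point_bilinear s01 (sqrtr_ge0 _) (sqrtr_ge0 _) (powR_ge0 _ _) (powR_ge0 _ _)).
rewrite expect_cons ler_wpM2r//.
have e b : expect (fun x => f (cons_cube b x) * Tnoise s g (cons_cube b x)) <=
   F b * ((1 + s * (-1) ^+ b) / 2 * G false + (1 - s * (-1) ^+ b) / 2 * G true).
  have -> : expect (fun x => f (cons_cube b x) * Tnoise s g (cons_cube b x)) =
     (1 + s * (-1) ^+ b) / 2 * expect (fun x => f (cons_cube b x) * Tnoise s (fun y => g (cons_cube false y)) x) +
     (1 - s * (-1) ^+ b) / 2 * expect (fun x => f (cons_cube b x) * Tnoise s (fun y => g (cons_cube true y)) x).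
    rewrite -!expectZ -expectD; congr expect; apply/funext => x.
    by rewrite Tnoise_cons; ring.
  rewrite mulrDr; apply: lerD; rewrite [leRHS]mulrCA ler_wpM2l ?IH//.
    by case: (b); rewrite ?expr0 ?expr1 divr_ge0//; lra.
  by case: (b); rewrite ?expr0 ?expr1 divr_ge0//; lra.
have := lerD (e false) (e true); rewrite expr0 expr1 !mulr1 !mulrN1 opprK; exact.
Qed.

(** Duality: q = 1 + 1/s^2 is conjugate to p = 1 + s^2, and [hyper] is tested against sg(u)|u|^(q-1)
    with u = T_s g. *)
Lemma hyper_q n s (g : cube n -> R) : 0 < s <= 1 ->
  expect (fun x => `|Tnoise s g x| `^ (1 + (s ^+ 2)^-1)) <=
  expect (fun x => g x ^+ 2) `^ ((1 + (s ^+ 2)^-1) / 2).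
Proof.
move=> /andP[s0 s1]; set q : R := 1 + (s ^+ 2)^-1; pose p : R := 1 + s ^+ 2.
have s20 : 0 < s ^+ 2 by rewrite exprn_gt0.
have q1 : 0 < q - 1 by rewrite /q addrAC subrr add0r invr_gt0.
have q0 : 0 < q by lra.
have p0 : 0 < p by rewrite ltr_wpDr// ltW.
have qp : (q - 1) * p = q.
  by rewrite /q /p addrAC subrr add0r mulrDr mulr1 mulVf ?gt_eqF// addrC.
have pq : 1 - p^-1 = q^-1.
  rewrite -qp invfM /q addrAC subrr add0r invrK; apply: (mulIf (lt0r_neq0 p0)).
  by rewrite mulrBl mul1r mulVf ?divfK ?lt0r_neq0// /p; ring.
pose u := Tnoise s g; set X := expect _; set E := expect (fun x => g x ^+ 2).
have X0 : 0 <= X by apply: expect_ge0 => x; exact: powR_ge0.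
have E0 : 0 <= E by apply: expect_ge0 => x; exact: sqr_ge0.
pose h x := Num.sg (u x) * `|u x| `^ (q - 1).
have e1 : X = expect (fun x => g x * Tnoise s h x).
  rewrite expect_Tnoise /X; congr expect; apply/funext => x.
  by rewrite /h mulrA (mulrC _ (Num.sg _)) -normrEsg mulr_powRB1.
have e2 : expect (fun x => `|h x| `^ p) = X.
  congr expect; apply/funext => x.
  rewrite /h normrM (ger0_norm (powR_ge0 _ _)) -/(u x).
  have [->|ux] := eqVneq (u x) 0.
    by rewrite sgr0 normr0 mul0r !powR0// gt_eqF.
  by rewrite normr_sg ux mul1r -powRrM qp.
have := @hyper n s g h; rewrite -e1 e2 -/p -/E => /(_ _).
rewrite (ltW s0) s1 => /(_ isT) H.
have [X00|Xn0] := eqVneq X 0; first by rewrite X00 powR_ge0.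
have Xp : 0 < X by rewrite lt_neqAle eq_sym Xn0.
have : X `^ q^-1 <= Num.sqrt E.
  rewrite -pq powRB ?Xn0 ?implybT// powRr1//.
  by rewrite ler_pdivrMr ?powR_gt0.
rewrite -(powR12_sqrt E0) => H2.
have eX : X = (X `^ q^-1) `^ q by rewrite -powRrM mulVf ?lt0r_neq0// powRr1.
rewrite eX (mulrC q) powRrM.
by apply: ge0_ler_powR; rewrite ?nnegrE ?powR_ge0// ltW.
Qed.

(** Since s^2 >= 1/2 the exponent q is at most 3, and |T_s g| <= 1 allows replacing the cube by the
    power q. The exponent of kappa is q/2 - 1; one full factor E[g^2] is kept so that it can be
    summed over coordinates. *)
Lemma hyper_cube n s (g : cube n -> R) (kappa : R) : 0 < s <= 1 -> 1 / 2 <= s ^+ 2 ->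
  (forall x, `|g x| <= 1) -> expect (fun x => g x ^+ 2) <= kappa ->
  expect (fun x => `|Tnoise s g x| ^+ 3) <=
  expect (fun x => g x ^+ 2) * kappa `^ ((1 - s ^+ 2) / (2 * s ^+ 2)).
Proof.
move=> s01 s2 g1 Ek; have /andP[s0 s1] := s01.
have s20 : 0 < s ^+ 2 by rewrite exprn_gt0.
have s21 : s ^+ 2 <= 1 by rewrite expr_le1// ltW.
have E0 : 0 <= expect (fun x => g x ^+ 2) by apply: expect_ge0 => x; exact: sqr_ge0.
have T1 x : `|Tnoise s g x| <= 1.
  rewrite (le_trans (ler_norm_sum _ _ _))// -(noise_sum1 s x); apply: ler_sum => z _.
  by rewrite normrM ger0_norm ?noise_ge0 ?(ltW s0)// ler_piMr ?noise_ge0 ?(ltW s0).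
apply: (@le_trans _ _ (expect (fun x => `|Tnoise s g x| `^ (1 + (s ^+ 2)^-1)))).
  apply: le_expect => x; rewrite -[leLHS]powR_mulrn//.
  have [->|ux] := eqVneq (Tnoise s g x) 0.
    by rewrite normr0 powR0 ?pnatr_eq0//; exact: powR_ge0.
  rewrite ger_powR// ?normr_gt0 ?ux ?T1//.
  have : (s ^+ 2)^-1 <= 2; last by lra.
  by rewrite invf_ple ?posrE//; lra.
apply: (le_trans (hyper_q _ s01)).
set E := expect _ in E0 Ek *.
have a0 : 0 <= (1 - s ^+ 2) / (2 * s ^+ 2) by rewrite divr_ge0 ?mulr_ge0 ?subr_ge0// ltW.
rewrite (_ : _ / 2 = 1 + (1 - s ^+ 2) / (2 * s ^+ 2)); last by field; rewrite gt_eqF.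
have := @mulr_powRB1 _ E (1 + (1 - s ^+ 2) / (2 * s ^+ 2)) E0.
rewrite addrAC subrr add0r => <-; last by rewrite ltr_wpDr.
by rewrite ler_wpM2l//; apply: ge0_ler_powR; rewrite ?nnegrE// (le_trans E0).
Qed.

End hyper.

(** * Gaussian quadrants *)

Section Lambda.
Context {R : realType}.
Implicit Types (x y a b c k : R).
#[local] Existing Instance der_phi.
#[local] Existing Instance der_Phi.
Local Notation mu := (@lebesgue_measure R).

Lemma integral_normal (U : set (measurableTypeR R)) (f : R -> \bar R) :
  measurable U -> measurable_fun U f ->
  (normal_prob (0:R) 1).-integrable U f ->
  (\int[normal_prob (0:R) 1]_(x in U) f x = \int[mu]_(x in U) (f x * (phi x)%:E))%E.
Proof.
move=> mU mf intf.
rewrite -(Radon_Nikodym_change_of_variables (normal_prob_dominates 0 1))//=.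
apply: ae_eq_integral => //.
- apply: emeasurable_funM => //; apply: (measurable_int mu).
  apply: (integrableS _ _ (@subsetT _ _)) => //=.
  by apply: Radon_Nikodym_integrable; exact: normal_prob_dominates.
- apply: emeasurable_funM => //=; apply/measurableT_comp => //=.
  by apply/measurable_funTS; exact: measurable_normal_pdf.
- apply: ae_eqe_mul2l => /=.
  rewrite Radon_NikodymE//=; first exact: normal_prob_dominates.
  move=> abmu; case: cid => /= h [h1 h2 h3].
  apply: integral_ae_eq => //=.
  + exact: integrableS h2.
  + by apply/measurable_funTS/measurableT_comp =>//; exact: measurable_normal_pdf.
  + by move=> E E01 mE; rewrite -h3.
Qed.

Section fixed_rho.
Variable rho : R.
Hypothesis rho01 : 0 <= rho < 1.
Let sig := Num.sqrt (1 - rho ^+ 2).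

Lemma sig_gt0 : 0 < sig.
Proof. by rewrite sqrtr_gt0; case/andP: rho01 => ? ?; nra. Qed.

Lemma sig_sq : sig ^+ 2 = 1 - rho ^+ 2.
Proof. by rewrite sqr_sqrtr//; case/andP: rho01 => ? ?; nra. Qed.

(** The density of G_1 at z times the conditional probability of G_2 <= b. Its integral [biv a b] is
    the bivariate Gaussian distribution function. *)
Let F b z := Phi ((b - rho * z) / sig) * phi z.

Definition biv : R -> R -> R := locked (fun a b => int_Ny (F b) a).

Lemma F_dom b : [/\ continuous (F b), forall z, 0 <= F b z & forall z, F b z <= 1 * phi z].
Proof.
split=> z.
- by rewrite /F; apply: der_continuous; apply: der_eq.
- by rewrite mulr_ge0 ?Phi_ge0 ?phi_ge0.
- by rewrite ler_wpM2r ?phi_ge0 ?Phi_le1.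
Qed.

Lemma bivE a b : biv a b = int_Ny (F b) a.
Proof. by rewrite /biv -lock. Qed.

Lemma der_biv b a : is_derive a 1 (biv^~ b) (F b a).
Proof.
have [c g0 g1] := F_dom b; have d := der_int_Ny c g0 g1 a.
by rewrite (_ : biv^~ b = int_Ny (F b))//; apply/funext => z; rewrite bivE.
Qed.

Lemma biv_ge0 a b : 0 <= biv a b.
Proof. rewrite bivE; have [c g0 g1] := F_dom b; exact: int_Ny_ge0. Qed.

Lemma biv_le a b : biv a b <= Phi a.
Proof.
rewrite bivE; have [c g0 g1] := F_dom b.
by rewrite (le_trans (int_Ny_le c g0 g1 a))// mul1r.
Qed.

(* Both sides are the joint density of (G_1, G_2), up to the factor 1 / sig. *)
Lemma phi_biv a b : phi ((b - rho * a) / sig) * phi a = phi ((a - rho * b) / sig) * phi b.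
Proof.
rewrite !phiE mulrACA [RHS]mulrACA -!expRD; congr (_ * expR _).
by rewrite !exprMn !exprVn sig_sq; field; rewrite -sig_sq expf_neq0// gt_eqF// sig_gt0.
Qed.

(** By symmetry of the law, the derivative of [biv a b] in b is [F a b]. The proof differentiates in
    a: [phi_biv] turns the derivative of the error into a Taylor remainder of [Phi] times [phi], and
    everything vanishes at -oo. *)
Lemma biv_incr a b b' :
  `|biv a b' - biv a b - F a b * (b' - b)| <= (sig ^+ 2)^-1 * (b' - b) ^+ 2.
Proof.
set M := _ * _ ^+ 2; have s0 := sig_gt0; have sn : sig != 0 by rewrite gt_eqF.
pose Er z := biv z b' - biv z b - F z b * (b' - b).
pose dEr z := F b' z - F b z - phi ((b - rho * z) / sig) * phi z / sig * (b' - b).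
have M0 : 0 <= M by rewrite mulr_ge0 ?sqr_ge0// invr_ge0 sqr_ge0.
have dEr' (z : R) : is_derive z 1 Er (dEr z).
  have d1 := der_biv b z; have d2 := der_biv b' z.
  rewrite /Er /F; apply: der_eq; rewrite /GRing.scale/= /dEr phi_biv; field.
  exact: sn.
have bd z : `|dEr z| <= M * phi z.
  rewrite (_ : dEr z = (Phi ((b' - rho * z) / sig) - Phi ((b - rho * z) / sig) -
    phi ((b - rho * z) / sig) * ((b' - rho * z) / sig - (b - rho * z) / sig)) * phi z); last first.
    by rewrite /dEr /F; field.
  rewrite normrM (ger0_norm (phi_ge0 z)) ler_wpM2r ?phi_ge0//.
  rewrite (le_trans (Phi_taylor _ _))// /M le_eqVlt; apply/orP; left; apply/eqP.
  by field.
have c0 : (F z b @[z --> -oo] --> (0:R))%classic.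
  rewrite /F -[X in (_ --> X)%classic](mul0r (phi b)); apply: cvgM; last exact: cvg_cst.
  apply: (cvg_comp _ _ _ Phi_cvgNy).
  apply/cvgrNyPle => A; near=> z.
  rewrite ler_pdivrMr// lerBlDr.
  by near: z; apply: nbhs_ninfty_le; exact: num_real.
have cEr : (Er z @[z --> -oo] --> (0:R))%classic.
  rewrite (_ : (0:R) = 0 - 0 - 0 * (b' - b)); last by ring.
  have cb u : (biv z u @[z --> -oo] --> (0:R))%classic.
    apply: (@squeeze_cvgr _ _ _ _ (cst 0) (@Phi R)); [|exact: cvg_cst|exact: Phi_cvgNy].
    by near=> z; rewrite biv_ge0 biv_le.
  by apply: cvgB; [apply: cvgB; exact: cb|apply: cvgM => //; exact: cvg_cst].
have cP : (M * Phi z @[z --> -oo] --> (0:R))%classic.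
  by have := cvgM (cvg_cst M) (@Phi_cvgNy R); rewrite mulr0; apply.
have h1 : 0 <= M * Phi a - Er a.
  apply: (@ge0_at_Ny _ (fun z => M * Phi z - Er z) (fun z => M * phi z - dEr z)).
  - by move=> z _; rewrite subr_ge0 (le_trans (ler_norm _))// bd.
  - by have := cvgB cP cEr; rewrite subr0; apply.
have h2 : 0 <= M * Phi a + Er a.
  apply: (@ge0_at_Ny _ (fun z => M * Phi z + Er z) (fun z => M * phi z + dEr z)).
  - move=> z _; rewrite -[dEr z]opprK subr_ge0 (le_trans (ler_norm _))// normrN bd//.
  - by have := cvgD cP cEr; rewrite addr0; apply.
have : M * Phi a <= M by rewrite ler_piMr// Phi_le1.
by rewrite -/(Er a) ler_norml; lra.
Unshelve. all: by end_near. Qed.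

Lemma F_lip b a a' : `|F b a' - F b a| <= (rho / sig + 1) * `|a' - a|.
Proof.
have s0 := sig_gt0; have sn : sig != 0 by rewrite gt_eqF.
have /andP[r0 r1] := rho01.
have d (z : R) : is_derive z 1 (F b)
   (- (rho / sig) * (phi ((b - rho * z) / sig) * phi z) - Phi ((b - rho * z) / sig) * (z * phi z)).
  by rewrite /F; apply: der_eq; rewrite /GRing.scale/=; field.
apply: (mvt_norm (fun z _ => d z)) => z _.
rewrite (le_trans (ler_normB _ _))// lerD//.
  have rs : 0 <= rho / sig by apply: divr_ge0 => //; exact: ltW.
  rewrite normrM normrN (ger0_norm rs) ler_piMr//.
  by rewrite ger0_norm ?mulr_ge0 ?phi_ge0// mulr_ile1 ?phi_ge0 ?phi_le1.
by rewrite normrM (ger0_norm (Phi_ge0 _)) mulr_ile1 ?Phi_ge0 ?Phi_le1 ?norm_phi_le1.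
Qed.

Lemma F_lip2 b b' a : `|F b' a - F b a| <= sig^-1 * `|b' - b|.
Proof.
have s0 := sig_gt0; rewrite /F -mulrBl normrM (ger0_norm (phi_ge0 a)).
rewrite (@le_trans _ _ (`|Phi ((b' - rho * a) / sig) - Phi ((b - rho * a) / sig)|))//.
  by rewrite ler_piMr// phi_le1.
rewrite (le_trans (Phi_lip _ _))// -mulrBl normrM [leLHS]mulrC normfV (gtr0_norm s0).
by rewrite opprB addrA subrK.
Qed.

Let k0 := Num.sqrt ((1 - rho) / (1 + rho)).

(** On the diagonal both partial derivatives are [F y y], and (y - rho y)/sig = k0 y. This is the
    origin of the formula for [V]. *)
Lemma der_biv_diag y : is_derive y 1 (fun y => biv y y) (2 * Phi (k0 * y) * phi y).
Proof.
have s0 := sig_gt0; have sn : sig != 0 by rewrite gt_eqF.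
have /andP[r0 r1] := rho01.
have k0E : k0 = (1 - rho) / sig.
  rewrite /k0 (_ : (1 - rho) / (1 + rho) = ((1 - rho) / sig) ^+ 2).
    by rewrite sqrtr_sqr ger0_norm// divr_ge0 ?ltW// subr_gt0.
  rewrite exprMn exprVn sig_sq; field.
  by rewrite !gt_eqF//; nra.
have -> : 2 * Phi (k0 * y) * phi y = F y y * 1 + F y y * 1.
  rewrite (_ : F y y = Phi (k0 * y) * phi y); first by ring.
  by rewrite /F; congr (Phi _ * _); rewrite k0E; field.
pose C := (sig ^+ 2)^-1 + sig^-1 + (rho / sig + 1).
apply: (@der_comp2 _ biv (F y y) (F y y) C id id y 1 1) => a b.
have h1 := biv_incr a y b.
have h2 := F_lip2 y a y.
have h3 := @taylor1 _ (biv^~ y) (F y) (rho / sig + 1) y a (der_biv y) (fun x => F_lip y y x).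
rewrite (_ : _ - _ - _ - _ = (biv a b - biv a y - F a y * (b - y)) +
  (F a y - F y y) * (b - y) + (biv a y - biv y y - F y y * (a - y))); last by ring.
rewrite (le_trans (ler_normD _ _))// (le_trans (lerD (ler_normD _ _) h3))//.
rewrite (le_trans (lerD (lerD h1 (lexx _)) (lexx _)))//.
have h4 : `|(F a y - F y y) * (b - y)| <= sig^-1 * ((a - y) ^+ 2 + (b - y) ^+ 2).
  rewrite normrM (le_trans (ler_wpM2r (normr_ge0 _) h2))// -mulrA.
  apply: ler_wpM2l; first by rewrite invr_ge0 ltW.
  rewrite -(real_normK (num_real (a - y))) -(real_normK (num_real (b - y))).
  have := sqr_ge0 (`|a - y| - `|b - y|); have := sqr_ge0 `|a - y|; have := sqr_ge0 `|b - y|.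
  by rewrite sqrrB; lra.
have i1 : 0 <= (sig ^+ 2)^-1 by rewrite invr_ge0 sqr_ge0.
have i3 : 0 <= rho / sig + 1.
  by rewrite addr_ge0// divr_ge0//; exact: ltW.
have := sqr_ge0 (a - y); have := sqr_ge0 (b - y).
by rewrite /C; nra.
Qed.

Lemma biv_diagE y : biv y y = V k0 y.
Proof.
pose D z := biv z z - V k0 z.
have d (z : R) : is_derive z 1 D 0.
  by apply: (der_eq (derB (der_biv_diag z) (der_V k0 z))); rewrite subrr.
have cD : (D z @[z --> -oo] --> (0:R))%classic.
  rewrite -(subr0 (0:R)); apply: cvgB.
    apply: (@squeeze_cvgr _ _ _ _ (cst 0) (@Phi R)); [|exact: cvg_cst|exact: Phi_cvgNy].
    by near=> z; rewrite biv_ge0 biv_le.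
  apply: (@squeeze_cvgr _ _ _ _ (cst 0) (fun z => 2 * Phi z)); [|exact: cvg_cst|].
    by near=> z; rewrite V_ge0 V_le.
  by have := cvgM (cvg_cst (2:R)) (@Phi_cvgNy R); rewrite mulr0; apply.
have e : D = cst (D y) by apply/funext => z; exact: is_derive_0_is_cst.
move: cD; rewrite e => cD.
have : D y = 0 by exact: (cvg_unique (@norm_hausdorff _ _) (cvg_cst _) cD).
by rewrite /D; lra.
Unshelve. all: by end_near. Qed.

Lemma LambdaE a : 0 < a < 1 -> Lambda rho a = (V k0 (Phi_inv a))%:E.
Proof.
move=> /andP[a0 a1]; rewrite /Lambda (gt_eqF a0) (lt_eqF a1) -biv_diagE.
set y := Phi_inv a; have s0 := sig_gt0.
pose G z : \bar R := (Phi ((y - rho * z) / sig))%:E.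
have mG (A : set (measurableTypeR R)) : measurable_fun A G.
  apply/measurable_EFinP; apply: measurable_funTS.
  by apply: continuous_measurable_fun => z; apply: der_continuous; apply: der_eq.
rewrite /product_measure1.
(* The section of the event at z is the half-line up to (y - rho z)/sig when z <= y, and empty
   otherwise. *)
transitivity (\int[normal_prob (0:R) 1]_(z in `]-oo, y]) G z)%E.
  rewrite [RHS]integral_mkcond; apply: eq_integral => z _.
  rewrite patchE /=; case: ifPn => [|].
    rewrite inE/= in_itv/= => zy; rewrite /G -Phi_fin; congr (normal_prob _ _ _).
    apply/seteqP; split => w /=; rewrite /xsection/= inE/= /gauss_pair/= in_itv/=.
      by move=> [_]; rewrite ler_pdivlMr// -/sig; lra.
    by rewrite ler_pdivlMr// -/sig => h; split => //; lra.
  rewrite notin_setE/= in_itv/= => zy.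
  rewrite (_ : xsection _ _ = set0) ?measure0//.
  by apply/seteqP; split => w //=; rewrite /xsection/= inE/= /gauss_pair/= => -[].
rewrite integral_normal//.
- rewrite bivE /int_Ny /Rintegral fineK.
    by apply: eq_integral => z _; rewrite /G /F EFinM.
  have [c g0 g1] := F_dom y.
  by apply: integrable_fin_num => //; exact: (dom_integrable c g0 g1).
- apply: measurable_bounded_integrable => //.
  + by rewrite (le_lt_trans (probability_le1 _ _)) ?ltry.
  + by have /measurable_EFinP := mG `]-oo, y]%classic.
  + exists 1; split => // M M1 z _ /=.
    by rewrite ger0_norm ?Phi_ge0// (le_trans (Phi_le1 _))// ltW.
Qed.

End fixed_rho.
End Lambda.

(** * The interpolation *)

(** The trapezoid bound for the increment 2 s x_i g of T_s h, divided by 2s; the cubic term becomes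
    4 M s^2 |g|^3 and s <= 1. *)
Lemma trapezoid_alg (R : realType) (s wa wb da db M sp g : R) :
  0 < s -> s <= 1 -> 0 <= M -> sp * sp = 1 ->
  (wa - wb) * (2 * s * sp * g) <=
    (da + db) / 2 * (2 * s * sp * g) ^+ 2 + M * `|2 * s * sp * g| ^+ 3 ->
  (wa - wb) * (sp * g) <= s * (da * g ^+ 2) + s * (db * g ^+ 2) + 4 * M * `|g| ^+ 3.
Proof.
move=> s0 s1 M0 spp T.
have nsp : `|sp| = 1.
  by apply/eqP; rewrite -(@eqrXn2 _ 2)// expr1n -normrX expr2 spp normr1.
have s20 : 0 < 2 * s by rewrite mulr_gt0.
rewrite -(ler_pM2l s20).
rewrite (_ : 2 * s * ((wa - wb) * (sp * g)) = (wa - wb) * (2 * s * sp * g)); last by ring.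
apply: (le_trans T); rewrite !normrM nsp mulr1 (gtr0_norm s0) normr_nat.
rewrite (_ : (2 * s * sp * g) ^+ 2 = 4 * s ^+ 2 * (sp * sp) * g ^+ 2); last by ring.
rewrite spp mulr1.
have Mg : 0 <= M * `|g| ^+ 3 by rewrite mulr_ge0// exprn_ge0.
have s3 : s ^+ 3 <= s by rewrite exprS ler_piMr ?expr_le1// ltW.
have : s ^+ 3 * (M * `|g| ^+ 3) <= s * (M * `|g| ^+ 3) by rewrite ler_wpM2r.
rewrite (_ : M * (2 * s * `|g|) ^+ 3 = 8 * (s ^+ 3 * (M * `|g| ^+ 3))); last by ring.
lra.
Qed.

Section flow.
Context {R : realType}.
Variables (n : nat) (rho eps : R) (h : cube n -> R).
Hypotheses (rho01 : 0 <= rho < 1) (eps0 : 0 < eps)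
  (heps : forall x, eps <= h x <= 1 - eps).
Let r := Num.sqrt rho.
Let W := 4 / (phi (1:R) * eps).
Let M := 8 / (phi (1:R) * eps) ^+ 2.

Lemma r_sq : r ^+ 2 = rho.
Proof. by rewrite sqr_sqrtr//; case/andP: rho01. Qed.

Lemma s_bounds s : 0 <= s <= r -> [/\ 0 <= s <= 1, s ^+ 2 <= rho & 0 < 1 - rho].
Proof.
move=> /andP[s0 sr]; have /andP[r0 r1] := rho01.
have s2 : s ^+ 2 <= rho by rewrite -r_sq lerXn2r// nnegrE// (le_trans s0).
split=> //; last by rewrite subr_gt0.
by rewrite s0/=; nra.
Qed.

(** This is sqrt((1 - c)/(1 + c)) for the correlation c = (rho - s^2)/(1 - s^2). *)
Definition slope s : R := Num.sqrt ((1 - rho) / (1 + rho - 2 * s ^+ 2)).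

Lemma slope_bounds s : 0 <= s <= r -> 0 < slope s /\ 0 <= slope s <= 1.
Proof.
move=> /s_bounds[s01 s2 r1].
have D0 : 0 < 1 + rho - 2 * s ^+ 2 by lra.
have k0 : 0 < slope s by rewrite sqrtr_gt0 divr_gt0.
split=> //; rewrite ltW//= -[leRHS]sqrtr1 ler_wsqrtr// ler_pdivrMr// mul1r; lra.
Qed.

Lemma der_slope s : 0 <= s <= r ->
  is_derive s 1 slope (2 * s * slope s / (1 + rho - 2 * s ^+ 2)).
Proof.
move=> sr; have [k0 _] := slope_bounds sr; have [s01 s2 r1] := s_bounds sr.
have D0 : 0 < 1 + rho - 2 * s ^+ 2 by lra.
have Dn : 1 + rho - 2 * s ^+ 2 != 0 by rewrite gt_eqF.
have dD' : is_derive s 1 (fun s => 1 + rho - 2 * s ^+ 2) (- 4 * s).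
  by apply: der_eq; rewrite /GRing.scale/=; lra.
have d1 := @is_deriveV R (fun s => 1 + rho - 2 * s ^+ 2) s _ 1 Dn dD'.
have q0 : 0 < (1 - rho) / (1 + rho - 2 * s ^+ 2) by rewrite divr_gt0.
have d2 := is_derive1_sqrt q0.
have d3 := @der_comp _ Num.sqrt (fun s => (1 - rho) / (1 + rho - 2 * s ^+ 2)) s _ _ d2
  (derZ (1 - rho) d1).
apply: (der_eq d3); rewrite /GRing.scale/=.
have k2 : slope s ^+ 2 = (1 - rho) / (1 + rho - 2 * s ^+ 2) by rewrite sqr_sqrtr// ltW.
have kn : slope s != 0 by rewrite gt_eqF.
rewrite -/(slope s).
transitivity ((2 * slope s)^-1 * (4 * s / (1 + rho - 2 * s ^+ 2)) * slope s ^+ 2).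
  by rewrite k2; field; rewrite kn Dn.
by field; rewrite kn Dn.
Qed.

Lemma hs_bounds s x : 0 <= s <= r -> eps <= Tnoise s h x <= 1 - eps.
Proof.
move=> /s_bounds[s01 _ _]; apply/andP; split.
  by rewrite -[leLHS](Tnoise_cst s eps x); apply: le_Tnoise => // z; case/andP: (heps z).
by rewrite -[leRHS](Tnoise_cst s (1 - eps) x); apply: le_Tnoise => // z; case/andP: (heps z).
Qed.

Lemma hs01 s x : 0 <= s <= r -> 0 < Tnoise s h x < 1.
Proof.
move=> /(hs_bounds x) /andP[a b]; rewrite (lt_le_trans eps0 a)/=.
by rewrite (le_lt_trans b)// ltrBlDr ltrDl.
Qed.

(* Constant in s when h is replaced by a half-space in Gauss space; this dictates
   the choice of slope. *)
Definition psi s : R := expect (fun x => V (slope s) (Phi_inv (Tnoise s h x))).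

(** The first term is [Vk] times the derivative of [slope]: since [Vk] = - Vxx phi(y)^2 / (k (1 +
    k^2)), the choice of [slope] leaves exactly the coefficient s/(1 - s^2). *)
Definition dpsi s x : R :=
  - (s / (1 - s ^+ 2) * (Vxx (slope s) (Tnoise s h x) * phi (Phi_inv (Tnoise s h x)) ^+ 2))
  + \sum_i Vx (slope s) (Tnoise s h x) * (spin R x i * pder s h i x).

Lemma der_V_flow s x : 0 <= s <= r ->
  is_derive s 1 (fun s => V (slope s) (Phi_inv (Tnoise s h x))) (dpsi s x).
Proof.
move=> sr; have [k0 _] := slope_bounds sr; have [s01 s2 r1] := s_bounds sr.
have D0 : 0 < 1 + rho - 2 * s ^+ 2 by lra.
have dk := der_slope sr; have dh := der_Tnoise h x s.
have dy := der_comp (der_Phi_inv (hs01 x sr)) dh.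
have := der_comp2 dk dy (V_quad _ _); set y := Phi_inv _ => d.
apply: (der_eq d); rewrite /dpsi -/y -mulr_sumr /Vx /Vxx -/y; set S := \sum_i _.
have p0 : phi y != 0 by rewrite gt_eqF// phi_gt0.
rewrite /Vk; congr (_ + _); last by field.
have k2 : slope s ^+ 2 = (1 - rho) / (1 + rho - 2 * s ^+ 2).
  by rewrite sqr_sqrtr// divr_ge0//; exact: ltW.
have -> : 1 + slope s ^+ 2 = 2 * (1 - s ^+ 2) / (1 + rho - 2 * s ^+ 2).
  by rewrite k2; field; rewrite gt_eqF.
by field; rewrite p0 !gt_eqF//; lra.
Qed.

Lemma der_psi s : 0 <= s <= r -> is_derive s 1 psi (expect (dpsi s)).
Proof.
move=> sr; have d := der_sum (fun x => der_V_flow x sr).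
rewrite /psi /expect; under eq_fun do rewrite mulrC; rewrite mulrC; exact: derZ.
Qed.

(* Integration by parts on the cube, up to the error of the trapezoid rule. *)
Lemma parts s i : 0 <= s <= r ->
  expect (fun x => Vx (slope s) (Tnoise s h x) * (spin R x i * pder s h i x)) <=
  s * expect (fun x => Vxx (slope s) (Tnoise s h x) * pder s h i x ^+ 2) +
  2 * M * expect (fun x => `|pder s h i x| ^+ 3).
Proof.
move=> sr; have [_ k01] := slope_bounds sr; have [s01 s2 _] := s_bounds sr.
have /andP[s0 s1] := s01.
set A := expect _; pose wx x := Vx (slope s) (Tnoise s h x).
pose dx x := Vxx (slope s) (Tnoise s h x).
(* Averaging over x and its flip: [pder] is invariant and the spin changes sign. *)
have e1 : 2 * A = expect (fun x => (wx x - wx (flip i x)) * (spin R x i * pder s h i x)).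
  have : A = expect (fun x => wx (flip i x) * - (spin R x i * pder s h i x)).
    rewrite /A -(expect_flip i); congr expect; apply/funext => x.
    by rewrite /wx spin_flip pder_flip mulNr.
  move=> e; rewrite mulr2n mulrDl mul1r {2}e -expectD; congr expect; apply/funext => x.
  by rewrite mulrN -mulrBl.
have M0 : 0 <= M by rewrite divr_ge0 ?sqr_ge0.
have e2 : expect (fun x => (wx x - wx (flip i x)) * (spin R x i * pder s h i x)) <=
   expect (fun x => s * (dx x * pder s h i x ^+ 2) +
     s * (dx (flip i x) * pder s h i (flip i x) ^+ 2) + 4 * M * `|pder s h i x| ^+ 3).
  apply: le_expect => x; rewrite pder_flip; set g := pder s h i x.
  have T := Vx_trapezoid eps0 (hs_bounds x sr) (hs_bounds (flip i x) sr) k01.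
  rewrite Tnoise_flip -/g -/(wx x) -/(wx _) -/(dx x) -/(dx _) -/M in T.
  have gn : 0 <= `|g| ^+ 3 by rewrite exprn_ge0.
  have : s = 0 \/ 0 < s by move: s0; rewrite le_eqVlt => /predU1P[<-|]; [left|right].
  case=> [s00|sp0].
    (* At s = 0 dividing by s is impossible, but T_0 h is constant and the increment vanishes. *)
    have := Tnoise_flip s h i x; rewrite {3}s00 !(mulr0, mul0r) => /subr0_eq eT.
    have -> : wx (flip i x) = wx x by rewrite /wx eT.
    by rewrite subrr mul0r s00 !mul0r !add0r mulr_ge0// mulr_ge0.
  exact: (trapezoid_alg sp0 s1 M0 (spin_sq i x) T).
rewrite !expectD !expectZ in e2.
rewrite (expect_flip i (fun x => dx x * pder s h i x ^+ 2)) in e2.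
by rewrite -/dx; move: e2; rewrite -e1 /dx; lra.
Qed.

(** After [parts], the bracket multiplying s Vxx is bounded by [level1] divided by 1 - s^2 >= 1 -
    rho. Only its upper bound enters, because s Vxx lies between 0 and W. *)
Lemma dpsi_le s t B : 0 <= s <= r -> 0 < t ->
  \sum_i expect (fun x => `|pder s h i x| ^+ 3) <= B ->
  expect (dpsi s) <= W * (t ^+ 2 / (1 - rho) + 6 * B / t ^+ 2) + 2 * M * B.
Proof.
move=> sr t0 EB; have [k0 k01] := slope_bounds sr; have [s01 s2 r1] := s_bounds sr.
have /andP[s0 s1] := s01.
have M0 : 0 <= M by rewrite divr_ge0 ?sqr_ge0.
have W0 : 0 <= W by rewrite divr_ge0// mulr_ge0 ?phi_ge0// ltW.
pose dx x := Vxx (slope s) (Tnoise s h x).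
pose f2 x := phi (Phi_inv (Tnoise s h x)) ^+ 2.
pose G2 x := \sum_i pder s h i x ^+ 2.
pose G3 x := \sum_i `|pder s h i x| ^+ 3.
have e1 : expect (dpsi s) <= expect (fun x => - (s / (1 - s ^+ 2) * (dx x * f2 x)) + s * (dx x * G2 x))
    + 2 * M * expect G3.
  rewrite /dpsi expectD expect_sum [X in _ <= X + _]expectD -addrA lerD2l.
  rewrite (le_trans (ler_sum _ (fun i _ => parts i sr)))// big_split/= -!mulr_sumr.
  rewrite /G3 expect_sum lerD2r -expect_sum -expectZ.
  rewrite le_eqVlt; apply/orP; left; apply/eqP; congr expect; apply/funext => x.
  by rewrite /G2 mulr_sumr.
have e2 : expect (fun x => - (s / (1 - s ^+ 2) * (dx x * f2 x)) + s * (dx x * G2 x)) <=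
   expect (fun x => W * (t ^+ 2 / (1 - rho)) + W * 6 / t ^+ 2 * G3 x).
  apply: le_expect => x.
  have h01 z : 0 <= h z <= 1.
    have /andP[a b] := heps z; rewrite (le_trans (ltW eps0) a)/=.
    by rewrite (le_trans b)// gerBl ltW.
  have L := level1 s01 t0 h01 (hs01 x sr); rewrite -/(f2 x) -/(G2 x) -/(G3 x) in L.
  have v0 : 0 < 1 - s ^+ 2 by lra.
  have d0 : 0 <= dx x by apply: Vxx_ge0; exact: ltW.
  have dW : dx x <= W by apply: Vxx_le => //; exact: hs_bounds.
  have G30 : 0 <= G3 x by apply: sumr_ge0 => i _; rewrite exprn_ge0.
  have L2 : G2 x - f2 x / (1 - s ^+ 2) <= t ^+ 2 / (1 - rho) + 6 * G3 x / t ^+ 2.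
    rewrite -(ler_pM2l v0) mulrBr [X in _ - X]mulrCA divff ?gt_eqF// mulr1 mulrDr.
    have : t ^+ 2 <= (1 - s ^+ 2) * (t ^+ 2 / (1 - rho)).
      by rewrite mulrCA ler_peMr ?sqr_ge0// ler_pdivlMr// mul1r; lra.
    have -> : (1 - s ^+ 2) * (6 * G3 x / t ^+ 2) = 6 * (1 - s ^+ 2) * G3 x / t ^+ 2 by ring.
    lra.
  have R0 : 0 <= t ^+ 2 / (1 - rho) + 6 * G3 x / t ^+ 2.
    by rewrite addr_ge0// divr_ge0 ?sqr_ge0 ?mulr_ge0// ltW.
  rewrite (_ : _ + s * _ = s * dx x * (G2 x - f2 x / (1 - s ^+ 2))); last by ring.
  rewrite (_ : _ + _ * G3 x = W * (t ^+ 2 / (1 - rho) + 6 * G3 x / t ^+ 2)); last by ring.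
  apply: (@le_trans _ _ (s * dx x * (t ^+ 2 / (1 - rho) + 6 * G3 x / t ^+ 2))).
    by rewrite ler_wpM2l// mulr_ge0.
  rewrite ler_wpM2r//; nra.
have e3 : expect (fun x => W * (t ^+ 2 / (1 - rho)) + W * 6 / t ^+ 2 * G3 x) =
    W * (t ^+ 2 / (1 - rho)) + W * 6 / t ^+ 2 * expect G3.
  by rewrite expectD expect_cst expectZ.
rewrite e3 in e2.
have EG : expect G3 <= B by rewrite /G3 expect_sum.
have : W * 6 / t ^+ 2 * expect G3 <= W * 6 / t ^+ 2 * B.
  by rewrite ler_wpM2l//; apply: divr_ge0; [exact: mulr_ge0|exact: sqr_ge0].
have : 2 * M * expect G3 <= 2 * M * B by rewrite ler_wpM2l// mulr_ge0.
have -> : W * (t ^+ 2 / (1 - rho) + 6 * B / t ^+ 2) =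
  W * (t ^+ 2 / (1 - rho)) + W * 6 / t ^+ 2 * B by ring.
lra.
Qed.

Lemma psi0 : psi 0 = V (Num.sqrt ((1 - rho) / (1 + rho))) (Phi_inv (expect h)).
Proof.
rewrite /psi /slope expr0n/= mulr0 subr0 -[RHS](@expect_cst R n); congr expect.
by apply/funext => x; rewrite Tnoise0.
Qed.

Lemma psir : psi r = Stab rho h.
Proof.
have r0 : 0 <= r <= r by rewrite sqrtr_ge0 lexx.
have [_ _ r1] := s_bounds r0.
have -> : Stab rho h = expect (fun x => h x * Tnoise r (Tnoise r h) x).
  by congr expect; apply/funext => x; rewrite Tnoise_comp -expr2 r_sq.
rewrite expect_Tnoise /psi; congr expect; apply/funext => x.
have -> : slope r = 1.
  rewrite /slope r_sq (_ : 1 + rho - 2 * rho = 1 - rho); last by ring.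
  by rewrite divff ?sqrtr1// gt_eqF.
by rewrite V1E Phi_invK ?hs01// expr2.
Qed.

Lemma flow t B : 0 < t ->
  (forall s, 0 <= s <= r -> \sum_i expect (fun x => `|pder s h i x| ^+ 3) <= B) ->
  Stab rho h <= V (Num.sqrt ((1 - rho) / (1 + rho))) (Phi_inv (expect h)) +
    (W * (t ^+ 2 / (1 - rho) + 6 * B / t ^+ 2) + 2 * M * B).
Proof.
move=> t0 HB; have r0 : 0 <= r by exact: sqrtr_ge0.
rewrite -psi0 -psir; set Z := (_ + _ * B).
have := mvt_le r0 der_psi (fun s sr => dpsi_le sr t0 (HB s sr)); rewrite -/Z subr0.
have r1 : r <= 1.
  have rr : 0 <= r <= r by rewrite r0 lexx.
  by have [/andP[_]] := s_bounds rr.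
have B0 : 0 <= B.
  rewrite (le_trans _ (HB 0 _)) ?lexx ?r0// sumr_ge0// => i _.
  by apply: expect_ge0 => x; rewrite exprn_ge0.
have r0' : 0 < 1 - rho by rewrite subr_gt0; case/andP: rho01.
have Z0 : 0 <= Z.
  have W0 : 0 <= W by rewrite divr_ge0// mulr_ge0 ?phi_ge0// ltW.
  have M0 : 0 <= M by rewrite divr_ge0 ?sqr_ge0.
  apply: addr_ge0; last by apply: mulr_ge0 => //; exact: mulr_ge0.
  apply: mulr_ge0 => //; apply: addr_ge0; apply: divr_ge0; rewrite ?sqr_ge0//.
    exact: ltW.
  exact: mulr_ge0.
have : Z * r <= Z by rewrite ler_piMr.
lra.
Qed.

End flow.

(** * Majority is stablest *)

Section cubic.
Context {R : realType}.
Variable n : nat.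
Implicit Types (f h : cube n -> R) (s rho kappa : R).

Lemma expect_of_Tnoise s f : expect (Tnoise s f) = expect f.
Proof.
have := expect_Tnoise s (fun _ => 1) f.
under eq_fun do rewrite mul1r; move=> ->.
by congr expect; apply/funext => x; rewrite Tnoise_cst mul1r.
Qed.

Lemma Tnoise_sq s f x : 0 <= s <= 1 -> Tnoise s f x ^+ 2 <= Tnoise s (fun z => f z ^+ 2) x.
Proof.
move=> s01; set m := Tnoise s f x.
have : 0 <= Tnoise s (fun z => f z ^+ 2 + (- (2 * m) * f z + m ^+ 2)) x.
  rewrite -[leLHS](Tnoise_cst s 0 x); apply: le_Tnoise => // z.
  by rewrite (_ : _ + _ = (f z - m) ^+ 2) ?sqr_ge0//; ring.
by rewrite TnoiseD TnoiseD TnoiseZ Tnoise_cst -/m; lra.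
Qed.

Lemma Tnoise_contract s f : 0 <= s <= 1 ->
  expect (fun x => Tnoise s f x ^+ 2) <= expect (fun x => f x ^+ 2).
Proof.
move=> s01; rewrite -(expect_of_Tnoise s (fun x => f x ^+ 2)).
by apply: le_expect => x; exact: Tnoise_sq.
Qed.

Lemma diff_le1 i f x : (forall z, 0 <= f z <= 1) -> `|diff i f x| <= 1.
Proof.
move=> f01; rewrite /diff !normrM normr_sign mul1r normfV normr_nat.
rewrite ler_pdivrMr// mul1r.
have /andP[? ?] := f01 x; have /andP[? ?] := f01 (flip i x).
by rewrite ler_norml; apply/andP; split; lra.
Qed.

(** The noise is split as s = sg s2 with sg^2 = (1 + rho)/2 >= 1/2. Hypercontractivity at sg
    extracts the power of kappa; [bessel] at s2 sums the squares, with 1 - s2^2 >= (1 - rho)/2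
    because s2^2 <= 2 rho/(1 + rho). *)
Lemma pder_cubic_bound rho s h kappa : 0 <= rho < 1 -> 0 <= s <= Num.sqrt rho ->
  (forall z, 0 <= h z <= 1) ->
  (forall i, expect (fun x => diff i h x ^+ 2) <= kappa) ->
  \sum_i expect (fun x => `|pder s h i x| ^+ 3) <=
  2 / (1 - rho) * kappa `^ ((1 - rho) / (2 * (1 + rho))).
Proof.
move=> /andP[r0 r1] /andP[s0 sr] h01 Ek.
pose sg := Num.sqrt ((1 + rho) / 2); pose s2 := s / sg.
have q0 : 0 < (1 + rho) / 2 by lra.
have sg2 : sg ^+ 2 = (1 + rho) / 2 by rewrite sqr_sqrtr// ltW.
have sg0 : 0 < sg by rewrite sqrtr_gt0.
have sg1 : sg <= 1 by rewrite -[leRHS]sqrtr1 ler_wsqrtr//; lra.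
have ss : s = sg * s2 by rewrite /s2 mulrC divfK// gt_eqF.
have s2sq : s ^+ 2 <= rho by rewrite -[leRHS]sqr_sqrtr// lerXn2r ?nnegrE ?sqrtr_ge0.
have s20 : 0 <= s2 by rewrite divr_ge0// ltW.
have s22 : s2 ^+ 2 * (1 + rho) <= 2 * rho.
  rewrite /s2 exprMn exprVn sg2 (_ : _ * _ = 2 * s ^+ 2); first by lra.
  by field; rewrite gt_eqF//; lra.
have s2v : (1 - rho) / 2 <= 1 - s2 ^+ 2 by have := sqr_ge0 s2; nra.
have s21 : s2 <= 1.
  by rewrite -[leRHS]ger0_norm// -[leLHS]ger0_norm// -ler_sqr ?nnegrE// !real_normK ?num_real// expr1n; lra.
have s201 : 0 <= s2 <= 1 by rewrite s20.
set a := (1 - rho) / _.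
have step i : expect (fun x => `|pder s h i x| ^+ 3) <=
    expect (fun x => pder s2 h i x ^+ 2) * kappa `^ a.
  have := @hyper_cube _ n sg (pder s2 h i) kappa.
  rewrite (_ : (1 - sg ^+ 2) / (2 * sg ^+ 2) = a); last first.
    by rewrite sg2 /a; field; rewrite !gt_eqF//; lra.
  move=> H; rewrite (_ : (fun x => `|pder s h i x| ^+ 3) = fun x => `|Tnoise sg (pder s2 h i) x| ^+ 3).
    apply: H.
    - by rewrite sg0.
    - by rewrite sg2; lra.
    - move=> x; rewrite pderE (le_trans (ler_norm_sum _ _ _))// -[leRHS](noise_sum1 s2 x).
      apply: ler_sum => z _.
      by rewrite normrM ger0_norm ?noise_ge0// ler_piMr ?noise_ge0// diff_le1.
    - rewrite (_ : pder s2 h i = Tnoise s2 (diff i h)).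
        by rewrite (le_trans (Tnoise_contract _ s201)).
      by apply/funext => x; rewrite pderE.
  apply/funext => x; rewrite pderE ss -Tnoise_comp; congr (`|Tnoise sg _ x| ^+ 3).
  by apply/funext => z; rewrite pderE.
rewrite (le_trans (ler_sum _ (fun i _ => step i)))// -mulr_suml ler_wpM2r ?powR_ge0//.
rewrite -expect_sum -[leRHS](@expect_cst R n); apply: le_expect => x.
have B := bessel x s201 h01.
have G0 : 0 <= \sum_i pder s2 h i x ^+ 2 by apply: sumr_ge0 => i _; rewrite sqr_ge0.
rewrite ler_pdivlMr ?subr_gt0//.
move: B G0; set G := \sum_i _; move=> B G0.
have : (1 - rho) / 2 * G <= (1 - s2 ^+ 2) * G by rewrite ler_wpM2r.
lra.
Qed.

End cubic.

Section main.
Context {R : realType}.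

Lemma Stab_le_expect n (rho : R) (f : cube n -> R) : 0 <= rho <= 1 ->
  (forall x, 0 <= f x <= 1) -> Stab rho f <= expect f.
Proof.
move=> r01 f01; apply: le_expect => x; have /andP[f0 f1] := f01 x.
rewrite ler_piMr// -(Tnoise_cst rho 1 x); apply: le_Tnoise => // z.
by case/andP: (f01 z).
Qed.

(** The first two terms collect the errors of [flow], with 16/phi(1) coming from 4/(phi(1) eps) at
    eps = e/4. The last one covers the 6 eps = 3e/2 lost in exchanging h and f. *)
Definition stab_const : R := 13 * (16 / phi 1) + 2 * (16 / phi 1) ^+ 2 + 2.

Lemma boolean_stab n (rho e : R) (f : cube n -> R) : 0 <= rho < 1 -> 0 < e <= 1 ->
  (forall x, f x = 0 \/ f x = 1) -> 0 < expect f < 1 ->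
  (forall i, Inf i f <= e `^ (27 / (1 - rho))) ->
  Stab rho f <= V (Num.sqrt ((1 - rho) / (1 + rho))) (Phi_inv (expect f)) +
    stab_const * e / (1 - rho).
Proof.
move=> r01 /andP[e0 e1] fb a01 Inff; have /andP[r0 r1] := r01.
have p0 := phi_gt0 (1:R).
have f01 x : 0 <= f x <= 1 by case: (fb x) => ->; rewrite ?lexx ?ler01.
pose eps := e / 4; pose h x := eps + (1 - 2 * eps) * f x.
have eps0 : 0 < eps by rewrite divr_gt0.
have eps1 : eps <= 1 / 2 by rewrite /eps; lra.
have heps x : eps <= h x <= 1 - eps.
  by rewrite /h; case: (fb x) => ->; apply/andP; split; lra.
have h01 x : 0 <= h x <= 1.
  by have /andP[? ?] := heps x; apply/andP; split; lra.
set kappa := e `^ _ in Inff.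
have dh i : expect (fun x => diff i h x ^+ 2) <= kappa.
  apply: le_trans (Inff i); apply: le_expect => x.
  rewrite (_ : diff i h x ^+ 2 = (1 - 2 * eps) ^+ 2 / 4 * (spin R x i * spin R x i) *
     (f x - f (flip i x)) ^+ 2); last by rewrite /diff /h; field.
  rewrite spin_sq mulr1.
  (* For 0/1 values the squared difference is the absolute one, so [Inf] controls the L2 influence
     needed by hypercontractivity. *)
  have : (f x - f (flip i x)) ^+ 2 = `|f x - f (flip i x)|.
    by case: (fb x) => ->; case: (fb (flip i x)) => ->;
      rewrite ?subrr ?sub0r ?subr0 ?normrN ?sqrrN ?normr1 ?normr0 ?expr1n ?expr0n.
  by move=> ->; rewrite ler_piMl//; nra.
pose B := 2 / (1 - rho) * e ^+ 6.
have HB s : 0 <= s <= Num.sqrt rho -> \sum_i expect (fun x => `|pder s h i x| ^+ 3) <= B.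
  move=> sr; rewrite (le_trans (pder_cubic_bound r01 sr h01 dh))// /B.
  rewrite ler_wpM2l ?divr_ge0 ?subr_ge0 ?(ltW r1)//.
  rewrite /kappa -powRrM -powR_mulrn ?(ltW e0)// ger_powR ?e0//.
  (* As rho < 1, this exponent is at least 27/4, and e <= 1 permits lowering it to 6. *)
  rewrite (_ : 27 / (1 - rho) * ((1 - rho) / (2 * (1 + rho))) = 27 / (2 * (1 + rho))); last by field; rewrite !gt_eqF//; lra.
  by rewrite ler_pdivlMr; lra.
have F := flow r01 eps0 heps e0 HB.
set k0 := Num.sqrt _ in F *.
have Eh : expect h = eps + (1 - 2 * eps) * expect f by rewrite /h expectD expect_cst expectZ.
have Eh01 : 0 < expect h < 1.
  by rewrite Eh; case/andP: a01 => ? ?; apply/andP; split; nra.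
have Vle : V k0 (Phi_inv (expect h)) <= V k0 (Phi_inv (expect f)) + 2 * eps.
  have VL := V_lip k0 (Phi_inv (expect f)) (Phi_inv (expect h)).
  rewrite !Phi_invK// in VL.
  have eL : `|expect h - expect f| <= eps.
    by rewrite Eh ler_norml; case/andP: a01 => ? ?; apply/andP; split; nra.
  by have := le_trans (ler_norm _) VL; lra.
have Sle : Stab rho f <= Stab rho h + 4 * eps.
  have T x : Tnoise rho h x = eps + (1 - 2 * eps) * Tnoise rho f x.
    by rewrite /h TnoiseD Tnoise_cst TnoiseZ.
  rewrite /Stab -(@expect_cst R n (4 * eps)) -expectD; apply: le_expect => x.
  have t0 : 0 <= Tnoise rho f x.
    rewrite -(Tnoise_cst rho 0 x); apply: le_Tnoise; first by rewrite r0 ltW.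
    by move=> z; case/andP: (f01 z).
  have t1 : Tnoise rho f x <= 1.
    rewrite -(Tnoise_cst rho 1 x); apply: le_Tnoise; first by rewrite r0 ltW.
    by move=> z; case/andP: (f01 z).
  by rewrite T /h; move: t0 t1; set t := Tnoise _ _ _; case: (fb x) => ->; nra.
have rr : 0 < 1 - rho by lra.
pose X := e / (1 - rho).
have X0 : 0 <= X by rewrite divr_ge0// ltW.
have eX : e <= X by rewrite /X ler_pdivlMr//; nra.
pose P : R := 16 / phi 1.
have P0 : 0 <= P by rewrite divr_ge0// ltW.
have err : 4 / (phi 1 * eps) * (e ^+ 2 / (1 - rho) + 6 * B / e ^+ 2) +
    2 * (8 / (phi 1 * eps) ^+ 2) * B <= (13 * P + 2 * P ^+ 2) * X.
  have -> : 4 / (phi 1 * eps) * (e ^+ 2 / (1 - rho) + 6 * B / e ^+ 2) +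
    2 * (8 / (phi 1 * eps) ^+ 2) * B = P * X * (1 + 12 * e ^+ 2) + P ^+ 2 * X * 2 * e ^+ 3.
    by rewrite /B /eps /X /P; field; rewrite !gt_eqF.
  have PX : 0 <= P * X by exact: mulr_ge0.
  have PPX : 0 <= P ^+ 2 * X by rewrite mulr_ge0// sqr_ge0.
  have e2 : e ^+ 2 <= 1 by rewrite expr_le1// ltW.
  have e3 : e ^+ 3 <= 1 by rewrite expr_le1// ltW.
  have := ler_wpM2l PX e2; have := ler_wpM2l PPX e3; lra.
rewrite /stab_const -/P -mulrA -/X [X in _ + X]mulrDl.
by move: F err Vle Sle; rewrite /eps; lra.
Qed.

Lemma le_MaxInf n (f : cube n -> R) i : Inf i f <= MaxInf f.
Proof. by rewrite /MaxInf; apply: le_bigmax. Qed.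

End main.

Theorem theorem5 (R : realType) :
  exists C : R, 0 < C /\
    forall (n : nat) (rho kappa : R) (g : cube n -> R),
      (1 <= n)%N ->
      0 <= rho <= 1 ->
      0 <= kappa ->
      (forall x, g x = 0 \/ g x = 1) ->
      MaxInf g <= kappa ->
      ((Stab rho g)%:E <=
       Lambda rho (expect g) +
       (if (rho == 1)%R then +oo
        else (C / (1 - Num.sqrt rho) * kappa `^ ((1 - rho) / 27))%R%:E))%E.
Proof.
have p0 := phi_gt0 (1:R).
have K2 : 2 <= @stab_const R.
  have P0 : 0 <= 16 / phi (1:R) by apply: divr_ge0 => //; exact: ltW.
  rewrite /stab_const; move: P0; set P := 16 / _ => P0.
  by have := sqr_ge0 P; lra.
exists stab_const; split; first by lra.
move=> n rho kappa g _ r01 k0 gb gk; have /andP[r0 r1] := r01.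
have g01 x : 0 <= g x <= 1 by case: (gb x) => ->; rewrite ?lexx ?ler01.
have a0 : 0 <= expect g by apply: expect_ge0 => x; case/andP: (g01 x).
have a1 : expect g <= 1.
  by rewrite -(@expect_cst R n 1); apply: le_expect => x; case/andP: (g01 x).
have Sa := Stab_le_expect r01 g01.
have L0 : (0 <= Lambda rho (expect g))%E.
  by rewrite /Lambda; case: ifP => // _; case: ifP.
have [_|rn1] := eqVneq rho 1.
  have hL : (Lambda rho (expect g) != -oo)%E by apply: contraTneq L0 => ->.
  by rewrite addey// leey.
have rlt1 : rho < 1 by rewrite lt_neqAle rn1.
have r01' : 0 <= rho < 1 by rewrite r0.
have q1 : Num.sqrt rho < 1 by rewrite -[ltRHS]sqrtr1 ltr_sqrt.
have q0 : 0 <= Num.sqrt rho by exact: sqrtr_ge0.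
have rq : rho <= Num.sqrt rho by rewrite -{1}(sqr_sqrtr r0); nra.
set D := _ * kappa `^ _.
have D0 : 0 <= D by rewrite mulr_ge0 ?powR_ge0// divr_ge0 ?subr_ge0 ?(ltW q1)//; lra.
have [ea|an0] := eqVneq (expect g) 0.
  by rewrite ea /Lambda eqxx add0e lee_fin (le_trans Sa)// ea.
have [ea|an1] := eqVneq (expect g) 1.
  rewrite ea /Lambda oner_eq0 eqxx -EFinD lee_fin (le_trans Sa)// ea.
  by rewrite lerDl.
have a01 : 0 < expect g < 1 by rewrite !lt_neqAle eq_sym an0 an1 a0.
rewrite LambdaE// -EFinD lee_fin; set v := V _ _.
have v0 : 0 <= v by exact: V_ge0.
(* Here 1/(1 - rho) is weakened to 1/(1 - sqrt rho), since rho <= sqrt rho. The parameter e stays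
   free to cover kappa = 0. *)
have bound e : 0 < e <= 1 -> kappa <= e `^ (27 / (1 - rho)) ->
    Stab rho g <= v + stab_const / (1 - Num.sqrt rho) * e.
  move=> e01 ke; have := @boolean_stab _ n rho e g r01' e01 gb a01.
  move=> H; apply: le_trans (H _) _.
    by move=> i; rewrite (le_trans (le_MaxInf g i))// (le_trans gk).
  rewrite lerD2l [leRHS]mulrAC ler_wpM2l//.
    by case/andP: e01 => /ltW e0 _; rewrite mulr_ge0//; lra.
  by rewrite lef_pV2 ?posrE; lra.
have [kge1|klt1] := leP 1 kappa.
  (* For kappa >= 1 the error term alone exceeds the trivial bound Stab <= E[g] <= 1. *)
  have : 1 <= D.
    have h1 : 1 <= kappa `^ ((1 - rho) / 27).
      by rewrite -[leLHS](powRr0 kappa) ler_powR// divr_ge0//; lra.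
    have h2 : 1 <= stab_const / (1 - Num.sqrt rho) by rewrite ler_pdivlMr; lra.
    by rewrite /D; nra.
  lra.
have [ke0|kn0] := eqVneq kappa 0.
  (* For kappa = 0 every e in (0, 1] is admissible, and e is taken so small that its error is at
     most d. *)
  apply/ler_addgt0Pr => d d0.
  set Q := stab_const / (1 - Num.sqrt rho) in bound D D0 *.
  have Q0 : 0 < Q by rewrite divr_gt0; lra.
  have := bound (Num.min 1 (d / Q)).
  rewrite lt_min ltr01 divr_gt0// ge_min lexx ke0 => /(_ isT (powR_ge0 _ _)).
  have : Q * Num.min 1 (d / Q) <= d.
    by rewrite mulrC -ler_pdivlMr// ge_min lexx orbT.
  lra.
have kp : 0 < kappa by rewrite lt_neqAle eq_sym kn0.
have := bound (kappa `^ ((1 - rho) / 27)).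
rewrite powR_gt0// -powRrM (_ : (1 - rho) / 27 * (27 / (1 - rho)) = 1); last first.
  by field; rewrite gt_eqF//; lra.
rewrite powRr1// lexx => H; apply: H => //=.
rewrite -[leRHS](powRr0 kappa) ger_powR// ?kp ?(ltW klt1)//.
by rewrite divr_ge0//; lra.
Qed.
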